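(* Let $G$ be a connected graph on $n$ vertices and let $k$ be a nonnegative integer. If $n\le 5k+2$, then one can check whether $\mathrm{ola}^+(G)\le k$, and compute $\mathrm{ola}^+(G)$ provided $\mathrm{ola}^+(G)\le k$, in time $O(2^{2.5551k})$.
   Context: All graphs are finite, without loops or parallel edges. A linear arrangement of $G=(V,E)$ is a bijection $\alpha:V\to\{1,\dots,|V|\}$; net cost $\mathrm{nc}(\alpha,G)=\sum_{uv\in E}(|\alpha(u)-\alpha(v)|-1)$; $\mathrm{ola}^+(G)$ is the minimum net cost over all linear arrangements of $G$. *)

(* Defs.v *)
From mathcomp Require Import all_boot.

Set Implicit Arguments.
Unset Strict Implicit.
Unset Printing Implicit Defensive.

Local Open Scope nat_scope.

Record sgraph := SGraph {
  svertex :> finType;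
  adj : rel svertex;
  adj_sym : symmetric adj;
  adj_irrefl : irreflexive adj }.

Definition connected_graph (G : sgraph) : Prop :=
  forall x y : G, connect (@adj G) x y.

(* Positions are numbered 0, ..., |V| - 1 instead of 1, ..., |V|; only
   differences of positions matter. Source and target have the same cardinal,
   so an injective map is a bijection. *)
Definition linear_arrangement (G : sgraph) : pred {ffun G -> 'I_#|G|} :=
  fun alpha => injectiveb alpha.

(* Each edge is counted once, from its left end u to its right end v, so the
   truncated subtractions are exact. *)
Definition net_cost (G : sgraph) (alpha : {ffun G -> 'I_#|G|}) : nat :=
  \sum_(u : G) \sum_(v : G | adj u v && (alpha u < alpha v))
    (alpha v - alpha u - 1).

Definition ola_plus (G : sgraph) : nat :=
  net_cost [arg min_(alpha < [ffun x : G => enum_rank x]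
                     | linear_arrangement alpha) net_cost alpha].

Lemma ola_plus_seed (G : sgraph) :
  linear_arrangement [ffun x : G => enum_rank x].
Proof.
apply/injectiveP => x y; rewrite !ffunE; exact: enum_rank_inj.
Qed.

Lemma ola_plusP (G : sgraph) :
  (exists2 alpha : {ffun G -> 'I_#|G|},
     linear_arrangement alpha & net_cost alpha = ola_plus G) /\
  (forall alpha : {ffun G -> 'I_#|G|},
     linear_arrangement alpha -> ola_plus G <= net_cost alpha).
Proof.
rewrite /ola_plus; case: arg_minnP; first exact: ola_plus_seed.
by move=> alpha la min_alpha; split=> //; exists alpha.
Qed.

(* Random access machine with the uniform cost measure: one time unit per
   executed instruction. Registers R_0, R_1, ... hold natural numbers; the only
   arithmetic is addition and truncated subtraction (no multiplication, so
   register contents gain at most one bit per step). *)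
Inductive instr :=
| IConst of nat & nat          (* IConst d c    : R_d := c *)
| IAdd of nat & nat & nat      (* IAdd d a b    : R_d := R_a + R_b *)
| ISub of nat & nat & nat      (* ISub d a b    : R_d := R_a - R_b, truncated *)
| ILoad of nat & nat           (* ILoad d a     : R_d := R_(R_a) *)
| IStore of nat & nat          (* IStore a b    : R_(R_a) := R_b *)
| IJump of nat                 (* IJump l       : goto l *)
| IJumpZero of nat & nat.      (* IJumpZero a l : if R_a = 0 then goto l *)

Definition program := seq instr.
Definition memory := nat -> nat.

Record config := Config { pc : nat; mem : memory }.

Definition upd (m : memory) (r x : nat) : memory :=
  fun i => if i == r then x else m i.

Definition exec_instr (i : instr) (c : config) : config :=
  let: Config p m := c in
  match i with
  | IConst d x => Config p.+1 (upd m d x)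
  | IAdd d a b => Config p.+1 (upd m d (m a + m b))
  | ISub d a b => Config p.+1 (upd m d (m a - m b))
  | ILoad d a => Config p.+1 (upd m d (m (m a)))
  | IStore a b => Config p.+1 (upd m (m a) (m b))
  | IJump l => Config l m
  | IJumpZero a l => Config (if m a == 0 then l else p.+1) m
  end.

(* The machine halts when the program counter leaves the program. *)
Definition halted (P : program) (c : config) : bool := size P <= pc c.

Definition step (P : program) (c : config) : config :=
  if onth P (pc c) is Some i then exec_instr i c else c.

(* A halted configuration is a fixpoint of step, so [halted P (run P m t)]
   means that P halts within t steps on the initial memory m. *)
Definition run (P : program) (m : memory) (t : nat) : config :=
  iter t (step P) (Config 0 m).

(* Input: R_0 = |V|, R_1 = k, followed by the 0/1 adjacency matrix in row-major
   order; all other registers are 0. *)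
Definition encode (G : sgraph) (k : nat) : memory :=
  nth 0 ([:: #|G|; k] ++ [seq nat_of_bool (adj u v) | u <- enum G, v <- enum G]).

(* Output: R_0 = 1 or 0 according to whether ola^+(G) <= k; if so, R_1 holds
   ola^+(G). *)
Definition correct_output (G : sgraph) (k : nat) (m : memory) : Prop :=
  m 0 = (ola_plus G <= k) /\ (ola_plus G <= k -> m 1 = ola_plus G).

Definition solves_within (P : program) (G : sgraph) (k t : nat) : Prop :=
  let c := run P (encode G k) t in halted P c /\ correct_output G k (mem c).

(* Main.v *)
Require Import Defs.
From mathcomp Require Import all_boot zify.

(** The net cost of an arrangement plus the number of edges is the sum of the
    cut sizes of its prefixes, so ola^+ is a shortest-path problem on the lattice
    of vertex sets. Over one gap there is at most one edge of length 1 and at most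
    two of length 2, so an arrangement of net cost at most k only has prefixes S
    with 2 cut(S) <= k + 4. In a connected graph S is determined by its trace on a
    root and by the edges of a spanning tree that it cuts, hence at most
    (10/9)^n 3^(k+6) sets satisfy this bound; with n <= 5k + 2 this is
    O(((10/9)^5 3)^k), where (10/9)^5 3 < 5.1 < 2^2.5. A breadth-first search over
    these sets, with a table indexed by bit masks, spends polynomial time on each
    of them. The random access machine is programmed in a small loop language
    with arrays, whose compilation preserves meaning and time. *)

Set Implicit Arguments.
Unset Strict Implicit.
Unset Printing Implicit Defensive.

Local Open Scope nat_scope.

(** * A loop language and its compilation *)

(** The weight 9 in the count is the best one. For every [x >= 1] the sets [D] with
    [2 * #|D| <= k + 6] number at most [(1 + 1/x) ^ n * x ^ (k/2 + 3)], and for [n = 5k] the growth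
    rate [(1 + 1/x) ^ 5 * x ^ (1/2)] is least at [x = 9]. The resulting rate 5.08 leaves room below
    [2 ^ (5/2)], about 5.66, for the polynomial factor. Pruning looks at the cut of a set alone,
    never at the cost accumulated so far, so the expanded sets can be counted independently of the
    search. It is sound because any path that reaches the full vertex set is an arrangement, and
    complete because an arrangement of net cost at most [k] has only good prefixes. On the machine
    side the obstacle is that the input may fill all low registers, leaving no place for variables,
    and that neither multiplication nor shifts are available. Addresses and digits are therefore
    produced by doubling, comparing and subtracting, and the matrix is moved away before the search
    begins. *)

Inductive cmd :=
| CConst of nat & nat
| CAdd of nat & nat & nat
| CSub of nat & nat & nat
| CGet of nat & nat & nat
| CPut of nat & nat & nat
| CSkip
| CSeq of cmd & cmd
| CIf of nat & cmd & cmd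
| CRep of nat & cmd.

Record state := State { vr : nat -> nat; ar : nat -> nat -> nat }.

Fixpoint den (c : cmd) (s : state) : state :=
  match c with
  | CConst x n => State (upd (vr s) x n) (ar s)
  | CAdd x y z => State (upd (vr s) x (vr s y + vr s z)) (ar s)
  | CSub x y z => State (upd (vr s) x (vr s y - vr s z)) (ar s)
  | CGet x a y => State (upd (vr s) x (ar s a (vr s y))) (ar s)
  | CPut a y x =>
      State (vr s)
        (fun b => if b == a then upd (ar s a) (vr s y) (vr s x) else ar s b)
  | CSkip => s
  | CSeq c1 c2 => den c2 (den c1 s)
  | CIf x c1 c2 => if vr s x == 0 then den c2 s else den c1 s
  | CRep x c1 => iter (vr s x) (den c1) s
  end.

(* Registers [0 .. NV-1] hold the variables, [NV] and [NV + 1] are scratch,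
   [NV + 2 + d] is the counter of the loop at depth [d], and cell [i] of array [a]
   lives at [NV + X + 2 ^ J * i + a], so that all arrays are unbounded. *)
Section Compiler.

Variables (NV X J : nat).
Let K := NV + X.
Let addr a i := K + (2 ^ J * i + a).

(** In the absence of multiplication the index is scaled by [J] doublings, which is why the stride
    is a power of two. *)
Definition compile_addr (a y : nat) : seq instr :=
  [:: IConst NV.+1 0; IAdd NV y NV.+1] ++ nseq J (IAdd NV NV NV)
    ++ [:: IConst NV.+1 (K + a); IAdd NV NV NV.+1].

(** Jump targets are absolute, hence [off]. A loop copies its count into a counter of its own, so
    its body may overwrite the variable. *)
Fixpoint compile (c : cmd) (off d : nat) : seq instr :=
  match c with
  | CConst x n => [:: IConst x n]
  | CAdd x y z => [:: IAdd x y z]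
  | CSub x y z => [:: ISub x y z]
  | CGet x a y => compile_addr a y ++ [:: ILoad x NV]
  | CPut a y x => compile_addr a y ++ [:: IStore NV x]
  | CSkip => [::]
  | CSeq c1 c2 =>
      let p1 := compile c1 off d in p1 ++ compile c2 (off + size p1) d
  | CIf x c1 c2 =>
      let p1 := compile c1 off.+1 d in
      let mid := (off + size p1).+2 in
      let p2 := compile c2 mid d in
      IJumpZero x mid :: p1 ++ IJump (mid + size p2) :: p2
  | CRep x c1 =>
      let r := NV + d.+2 in
      let p1 := compile c1 (off + 5) d.+1 in
      [:: IConst NV 0; IAdd r x NV; IJumpZero r (off + 6 + size p1);
          IConst NV 1; ISub r r NV]
        ++ p1 ++ [:: IJump (off + 2)]
  end.

(** The exact number of machine steps. A loop round adds 4 to its body: test, constant 1, decrement,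
    jump back. The final 3 are the two initial instructions and the last test. *)
Fixpoint cost (c : cmd) (s : state) : nat :=
  match c with
  | CGet _ _ _ | CPut _ _ _ => J + 5
  | CSkip => 0
  | CSeq c1 c2 => cost c1 s + cost c2 (den c1 s)
  | CIf x c1 c2 => if vr s x == 0 then (cost c2 s).+1 else (cost c1 s).+2
  | CRep x c1 =>
      (\sum_(i < vr s x) (cost c1 (iter i (den c1) s) + 4)) + 3
  | _ => 1
  end.

(** The bounds on [X] keep the scratch registers and the counters of all open loops below the first
    array cell. *)
Fixpoint wf (c : cmd) (d : nat) : bool :=
  match c with
  | CConst x _ => x < NV
  | CAdd x y z | CSub x y z => [&& x < NV, y < NV & z < NV]
  | CGet x a y | CPut a y x => [&& x < NV, y < NV, a < 2 ^ J & d.+1 < X]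
  | CSkip => true
  | CSeq c1 c2 => wf c1 d && wf c2 d
  | CIf x c1 c2 => [&& x < NV, wf c1 d & wf c2 d]
  | CRep x c1 => [&& x < NV, d.+2 < X & wf c1 d.+1]
  end.

Definition represents (s : state) (m : memory) : Prop :=
  (forall x, x < NV -> m x = vr s x) /\
  (forall a i, a < 2 ^ J -> m (addr a i) = ar s a i).

Definition code_at (P : program) (off : nat) (l : seq instr) : Prop :=
  forall i, i < size l -> onth P (off + i) = onth l i.

Lemma code_at_cat P off l1 l2 :
  code_at P off (l1 ++ l2) -> code_at P off l1 /\ code_at P (off + size l1) l2.
Proof.
move=> H; split=> i Hi.
  by rewrite H ?size_cat ?ltn_addr // onth_cat Hi.
rewrite -addnA H ?size_cat ?ltn_add2l // onth_cat ltnNge leq_addr /=.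
by rewrite addKn.
Qed.

Lemma code_at_cons P off x l :
  code_at P off (x :: l) -> onth P off = Some x /\ code_at P off.+1 l.
Proof.
by rewrite -cat1s => /code_at_cat[/(_ 0 isT)]; rewrite addn0 addn1.
Qed.

Lemma step_at P off m x :
  onth P off = Some x -> step P (Config off m) = exec_instr x (Config off m).
Proof. by rewrite /step /= => ->. Qed.

Lemma addr_inj a i b j : a < 2 ^ J -> b < 2 ^ J ->
  (addr a i == addr b j) = (a == b) && (i == j).
Proof.
move=> Ha Hb; rewrite /addr eqn_add2l.
apply/eqP/andP=> [E|[/eqP-> /eqP->]//].
have Eab : a = b.
  move: (congr1 (modn^~ (2 ^ J)) E).
  by rewrite ![2 ^ J * _]mulnC !modnMDl !modn_small.
by move: E; rewrite Eab => /eqP; rewrite eqn_add2r eqn_pmul2l ?expn_gt0.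
Qed.

(** These registers are the counters of the loops that enclose depth [d]. *)
Definition keeps (d : nat) (m m' : memory) : Prop :=
  forall r, NV.+1 < r < NV + d.+2 -> m' r = m r.

Lemma doublings P m off n v : code_at P off (nseq n (IAdd NV NV NV)) ->
  m NV = v ->
  exists m', [/\ iter n (step P) (Config off m) = Config (off + n) m',
    m' NV = 2 ^ n * v & forall r, r != NV -> m' r = m r].
Proof.
elim: n off m v => [|n IH] off m v /=.
  by move=> _ <-; exists m; rewrite addn0 mul1n.
move=> /code_at_cons[/step_at Es Hc] Hv.
have [m' [E1 E2 E3]] := IH off.+1 (upd m NV (m NV + m NV)) _ Hc erefl.
exists m'; split.
- by rewrite -iterS iterSr Es /= E1 addSnnS.
- by rewrite E2 /upd eqxx Hv expnS -mulnA mulnCA mul2n addnn -!mul2n; lia.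
- by move=> r Hr; rewrite E3 // /upd (negPf Hr).
Qed.

Lemma compile_addrP P off a y m : code_at P off (compile_addr a y) -> y < NV ->
  exists m', [/\ iter (J + 4) (step P) (Config off m) = Config (off + (J + 4)) m',
    m' NV = addr a (m y) & forall r, r != NV -> r != NV.+1 -> m' r = m r].
Proof.
move=> /code_at_cat[/code_at_cons[/step_at S1 /code_at_cons[/step_at S2 _]]].
move=> /code_at_cat[/doublings Hd].
rewrite size_nseq /= => /code_at_cons[/step_at S3 /code_at_cons[/step_at S4 _]] Hy.
set m1 := upd m NV.+1 0; set m2 := upd m1 NV (m1 y + m1 NV.+1).
have m2NV : m2 NV = m y.
  rewrite /m2 /m1 /upd !eqxx addn0.
  by rewrite (_ : (y == NV.+1) = false) //; lia.
have [m3 [E1 E2 E3]] := Hd m2 _ m2NV.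
set m4 := upd m3 NV.+1 (K + a).
exists (upd m4 NV (m4 NV + m4 NV.+1)); split.
- rewrite (_ : J + 4 = 2 + (J + 2)); last lia.
  rewrite addnC iterD /= S1 /= S2 /= -/m1 -/m2.
  rewrite addnC iterD -[off.+2]addn2 E1 /= S3 /= S4 /=.
  by congr Config; lia.
- rewrite /m4 /upd !eqxx (_ : (NV == NV.+1) = false); last lia.
  by rewrite E2 /addr; lia.
- move=> r H1 H2; rewrite /m4 /upd (negPf H1) (negPf H2) E3 // /m2 /m1 /upd.
  by rewrite (negPf H1) (negPf H2).
Qed.

Lemma represents_set s m x v : x < NV -> represents s m ->
  represents (State (upd (vr s) x v) (ar s)) (upd m x v).
Proof.
move=> Hx [H1 H2]; split=> [y Hy|a i Ha]; rewrite /upd /=.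
  by case: eqP => // _; exact: H1.
by rewrite -H2 // /addr /K ifF //; lia.
Qed.

Lemma represents_eq s m m' : represents s m ->
  (forall r, (r < NV) || (K <= r) -> m' r = m r) -> represents s m'.
Proof.
move=> [H1 H2] E; split=> [x Hx|a i Ha]; first by rewrite E ?Hx // H1.
by rewrite E ?H2 // /addr; lia.
Qed.

(** The step count is an equality, so that consecutive runs compose by splitting [iter]; [keeps]
    belongs to the induction because a loop must find its counter intact after the body. *)
Lemma compileP P c off d s m : wf c d -> code_at P off (compile c off d) ->
  represents s m ->
  exists m', [/\ iter (cost c s) (step P) (Config off m)
                   = Config (off + size (compile c off d)) m',
    represents (den c s) m' & keeps d m m'].
Proof.
elim: c off d s m => [x n|x y z|x y z|x a y|a y x||c1 IH1 c2 IH2|x c1 IH1 c2 IH2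
  |x c IH] off d s m /=.
- move=> Hx /code_at_cons[/step_at E _] Hr; exists (upd m x n).
  rewrite E addn1; split=> //; first exact: represents_set.
  by move=> r Hr'; rewrite /upd ifF //; lia.
- case/and3P=> Hx Hy Hz /code_at_cons[/step_at E _] Hr.
  exists (upd m x (m y + m z)); rewrite E addn1; split=> //.
    by rewrite !(proj1 Hr) //; apply: represents_set.
  by move=> r Hr'; rewrite /upd ifF //; lia.
- case/and3P=> Hx Hy Hz /code_at_cons[/step_at E _] Hr.
  exists (upd m x (m y - m z)); rewrite E addn1; split=> //.
    by rewrite !(proj1 Hr) //; apply: represents_set.
  by move=> r Hr'; rewrite /upd ifF //; lia.
- case/and4P=> Hx Hy Ha HX.
  rewrite -[X in code_at P off X]/(compile_addr a y ++ [:: ILoad x NV]).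
  move=> /code_at_cat[Hc].
  have -> : size (compile_addr a y) = J + 4.
    by rewrite /compile_addr !size_cat size_nseq /=; lia.
  move=> /code_at_cons[/step_at E _] Hr.
  have [m1 [E1 E2 E3]] := compile_addrP m Hc Hy.
  have Hr1 : represents s m1.
    by apply: represents_eq Hr _ => r Hr; apply: E3; rewrite /K in Hr; lia.
  exists (upd m1 x (m1 (addr a (m y)))); split.
  + rewrite addnS iterS E1 E /= E2; congr Config.
    by rewrite !size_cat size_nseq /=; lia.
  + by rewrite (proj2 Hr1) // (proj1 Hr) //; apply: represents_set.
  + by move=> r H; rewrite /upd ifF ?E3 //; lia.
- case/and4P=> Hx Hy Ha HX.
  rewrite -[X in code_at P off X]/(compile_addr a y ++ [:: IStore NV x]).
  move=> /code_at_cat[Hc].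
  have -> : size (compile_addr a y) = J + 4.
    by rewrite /compile_addr !size_cat size_nseq /=; lia.
  move=> /code_at_cons[/step_at E _] Hr.
  have [m1 [E1 E2 E3]] := compile_addrP m Hc Hy.
  have Hr1 : represents s m1.
    by apply: represents_eq Hr _ => r Hr; apply: E3; rewrite /K in Hr; lia.
  exists (upd m1 (addr a (m y)) (m1 x)); split.
  + rewrite addnS iterS E1 E /= E2; congr Config.
    by rewrite !size_cat size_nseq /=; lia.
  + case: Hr1 => H1 H2; split=> [z Hz|b i Hb] /=.
      by rewrite /upd ifF ?H1 // /addr /K; lia.
    rewrite /upd addr_inj // (proj1 Hr) // H1 //.
    by case: (b == a) / eqP => [->|_] /=; rewrite H2.
  + by move=> r H; rewrite /upd ifF ?E3 // /addr /K; lia.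
- by move=> _ _ Hr; exists m; rewrite addn0; split.
- case/andP=> W1 W2 /code_at_cat[C1 C2] Hr.
  have [m1 [E1 R1 K1]] := IH1 _ _ _ _ W1 C1 Hr.
  have [m2 [E2 R2 K2]] := IH2 _ _ _ _ W2 C2 R1.
  exists m2; split=> //.
    by rewrite addnC iterD E1 E2 size_cat addnA.
  by move=> r H; rewrite K2 // K1.
- case/and3P=> Hx W1 W2 /code_at_cons[/step_at S1].
  move=> /code_at_cat[C1 /code_at_cons[/step_at S2 C2]] Hr.
  rewrite -(proj1 Hr) //; case: eqP => Ex.
    have Ca : code_at P (off + size (compile c1 off.+1 d)).+2
        (compile c2 (off + size (compile c1 off.+1 d)).+2 d).
      by move: C2; rewrite addSn.
    have [m2 [E2 R2 K2]] := IH2 _ _ _ _ W2 Ca Hr.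
    exists m2; split=> //; rewrite iterSr S1 /= Ex /= E2; congr Config.
    by rewrite size_cat /=; lia.
  have [m1 [E1 R1 K1]] := IH1 _ _ _ _ W1 C1 Hr.
  exists m1; split=> //; rewrite iterS iterSr S1 /= (introF eqP Ex) E1 S2 /=.
  by congr Config; rewrite size_cat /=; lia.
- case/and3P=> Hx Hd W.
  move=> /code_at_cons[/step_at S1 /code_at_cons[/step_at S2]].
  move=> /code_at_cons[/step_at S3 /code_at_cons[/step_at S4]].
  move=> /code_at_cons[/step_at S5 /code_at_cat[C /code_at_cons[/step_at S6 _]]].
  move=> Hr; set r := NV + d.+2.
  set L := size (compile c (off + 5) d.+1).
  have Ca : code_at P (off + 5) (compile c (off + 5) d.+1).
    by rewrite {1}(_ : off + 5 = off.+4.+1) //; lia.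
  have loop n m0 s0 : m0 r = n -> represents s0 m0 -> exists m',
      [/\ iter ((\sum_(i < n) (cost c (iter i (den c) s0) + 4)) + 1) (step P)
            (Config off.+2 m0) = Config (off + 6 + L) m',
          represents (iter n (den c) s0) m' & keeps d m0 m'].
    elim: n m0 s0 => [|n IHn] m0 s0 Hn R0.
      exists m0; rewrite big_ord0 /= S3 /= Hn; split=> //.
    pose m1 := upd m0 NV 1; pose m2 := upd m1 r (m1 r - m1 NV).
    have R2 : represents s0 m2.
      apply: represents_eq R0 _ => x0; rewrite /m2 /m1 /upd /r /K => H0.
      by rewrite !ifF //; lia.
    have [m3 [E3 R3 K3]] := IH _ _ _ _ W Ca R2.
    have m3r : m3 r = n.
      rewrite K3 /r; last lia.
      rewrite /m2 /m1 /upd !eqxx -/r Hn (_ : (r == NV) = false); last by rewrite /r; lia.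
      lia.
    have [m4 [E4 R4 K4]] := IHn _ _ m3r R3.
    exists m4; split.
    + rewrite big_ord_recl; set rest := bigop _ _ _.
      rewrite (_ : _ + 1 = (rest + 1) + (cost c s0 + 3).+1); last by rewrite /=; lia.
      rewrite iterD iterS [iter (_ + 3) _ _]iterD.
      rewrite [iter 3 _ _]/= S3 /= -/r Hn /= S4 /= S5 /= -/r -/m1 -/m2.
      rewrite -[off.+4.+1](_ : off + 5 = _); last lia.
      rewrite E3 (_ : off + 5 + _ = off.+4.+1 + L); last by rewrite /L; lia.
      rewrite S6 /= (_ : off + 2 = off.+2); last lia.
      rewrite -E4; congr (iter _ _ _); congr (_ + 1).
      by apply: eq_bigr => i _; rewrite iterSr.
    + by rewrite iterSr.
    + move=> x0 H0; rewrite K4 // K3; last lia.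
      by rewrite /m2 /m1 /upd !ifF // /r; lia.
  pose m1 := upd m NV 0; pose m2 := upd m1 r (m1 x + m1 NV).
  have R2 : represents s m2.
    apply: represents_eq Hr _ => x0; rewrite /m2 /m1 /upd /r /K => H0.
    by rewrite !ifF //; lia.
  have m2r : m2 r = vr s x.
    rewrite /m2 /m1 /upd !eqxx (_ : (x == NV) = false); last lia.
    by rewrite (proj1 Hr) // addn0.
  have [m3 [E3 R3 K3]] := loop _ _ _ m2r R2.
  exists m3; split=> //.
    rewrite (_ : 3 = 1 + 2) // addnA.
    rewrite iterD /= S1 /= S2 /= -/r -/m1 -/m2 E3; congr Config.
    by rewrite size_cat /= -/L; lia.
  move=> x0 H0; rewrite K3 // /m2 /m1 /upd !ifF // /r; lia.
Qed.

End Compiler.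

(** * Frame rules, loop invariants and cost bounds *)

Fixpoint wvars (c : cmd) : seq nat :=
  match c with
  | CConst x _ | CAdd x _ _ | CSub x _ _ | CGet x _ _ => [:: x]
  | CPut _ _ _ | CSkip => [::]
  | CSeq c1 c2 | CIf _ c1 c2 => wvars c1 ++ wvars c2
  | CRep _ c1 => wvars c1
  end.

Fixpoint warrs (c : cmd) : seq nat :=
  match c with
  | CConst _ _ | CAdd _ _ _ | CSub _ _ _ | CGet _ _ _ | CSkip => [::]
  | CPut a _ _ => [:: a]
  | CSeq c1 c2 | CIf _ c1 c2 => warrs c1 ++ warrs c2
  | CRep _ c1 => warrs c1
  end.

(** A syntactic frame rule: on a concrete program its side condition is settled by computation, so
    values pass through a subprogram without entering its invariant. *)
Lemma den_vr_frame c s x : x \notin wvars c -> vr (den c s) x = vr s x.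
Proof.
elim: c s => //= [y n|y z t|y z t|y a z|c1 IH1 c2 IH2|y c1 IH1 c2 IH2|y c IH] s;
  rewrite ?inE ?mem_cat ?negb_or => Hx; rewrite /= /upd ?(negPf Hx) //.
- by case/andP: Hx => H1 H2; rewrite IH2 // IH1.
- by case/andP: Hx => H1 H2; case: ifP => _; rewrite ?IH1 ?IH2.
- by elim: (vr s y) => //= n <-; rewrite IH.
Qed.

Lemma den_ar_frame c s a : a \notin warrs c -> ar (den c s) a = ar s a.
Proof.
elim: c s => //= [b z y|c1 IH1 c2 IH2|y c1 IH1 c2 IH2|y c IH] s;
  rewrite ?inE ?mem_cat ?negb_or => Hx; rewrite /= ?(negPf Hx) //.
- by case/andP: Hx => H1 H2; rewrite IH2 // IH1.
- by case/andP: Hx => H1 H2; case: ifP => _; rewrite ?IH1 ?IH2.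
- by elim: (vr s y) => //= n <-; rewrite IH.
Qed.

Lemma den_rep (I : nat -> state -> Prop) x c s :
  I 0 s -> (forall i s', i < vr s x -> I i s' -> I i.+1 (den c s')) ->
  I (vr s x) (den (CRep x c) s).
Proof.
move=> I0 IS /=; elim: {-2}(vr s x) (leqnn (vr s x)) => //= i IHi Hi.
by apply: IS => //; apply: IHi; exact: ltnW.
Qed.

(** An estimate of [cost] freed from the state: [N] replaces every iteration count and the two
    branches of a conditional are added. *)
Fixpoint bound (J : nat) (c : cmd) (N : nat) : nat :=
  match c with
  | CGet _ _ _ | CPut _ _ _ => J + 5
  | CSkip => 0
  | CSeq c1 c2 => bound J c1 N + bound J c2 N
  | CIf _ c1 c2 => bound J c1 N + bound J c2 N + 2
  | CRep _ c1 => N * (bound J c1 N + 4) + 3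
  | _ => 1
  end.

Fixpoint loops_on (x : nat) (c : cmd) : bool :=
  match c with
  | CSeq c1 c2 | CIf _ c1 c2 => loops_on x c1 && loops_on x c2
  | CRep y c1 => (x == y) && loops_on x c1
  | _ => true
  end.

Lemma cost_rep J x c s B :
  (forall i, i < vr s x -> cost J c (iter i (den c) s) <= B) ->
  cost J (CRep x c) s <= vr s x * (B + 4) + 3.
Proof.
move=> H /=; rewrite leq_add2r -[X in X * _]card_ord -sum_nat_const.
by apply: leq_sum => i _; rewrite leq_add2r H.
Qed.

Lemma cost_bound J x c s : loops_on x c -> x \notin wvars c ->
  cost J c s <= bound J c (vr s x).
Proof.
elim: c s => //= [c1 IH1 c2 IH2|y c1 IH1 c2 IH2|y c IH] s.
- case/andP=> L1 L2; rewrite mem_cat negb_or => /andP[W1 W2].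
  by rewrite leq_add ?IH1 // (leq_trans (IH2 _ L2 W2)) // den_vr_frame.
- case/andP=> L1 L2; rewrite mem_cat negb_or => /andP[W1 W2].
  have := IH1 s L1 W1; have := IH2 s L2 W2.
  by case: ifP => _; lia.
- case/andP=> /eqP <- L W; apply: (@cost_rep J x c) => i _.
  apply: leq_trans (IH _ L W) _.
  suff -> : vr (iter i (den c) s) x = vr s x by [].
  by elim: i => //= i <-; rewrite den_vr_frame.
Qed.

Lemma bound_mono J c N N' : N <= N' -> bound J c N <= bound J c N'.
Proof.
move=> H; elim: c => //= [c1 IH1 c2 IH2|x c1 IH1 c2 IH2|x c IH].
- exact: leq_add.
- by rewrite leq_add2r leq_add.
- by rewrite leq_add2r leq_mul // leq_add2r.
Qed.

(* Telescoping along a potential bounds a loop whose iterations differ in cost. *)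
Lemma cost_rep_potential J (I : nat -> state -> Prop) (phi : state -> nat) x c s B C :
  I 0 s -> (forall i s', i < vr s x -> I i s' -> I i.+1 (den c s') /\
    cost J c s' + B * phi s' <= C + B * phi (den c s')) ->
  cost J (CRep x c) s + B * phi s
    <= vr s x * (C + 4) + 3 + B * phi (den (CRep x c) s).
Proof.
move=> I0 IS /=; set N := vr s x.
suff [_] : I N (iter N (den c) s) /\
  \sum_(i < N) (cost J c (iter i (den c) s) + 4) + B * phi s
    <= N * (C + 4) + B * phi (iter N (den c) s).
  by move=> H; rewrite addnAC [X in _ <= X]addnAC leq_add2r.
elim: {-2}N (leqnn N) => [|i IHi] Hi; first by rewrite big_ord0.
have [Ii Hs] := IHi (ltnW Hi); have [Ii1 Hc] := IS _ _ Hi Ii.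
split=> //; rewrite big_ord_recr /= mulSn.
move: Hs Hc; move: (bigop _ _ _) => S; lia.
Qed.

(** * Moving the input out of the low registers *)

Definition seqc := foldr CSeq CSkip.

(* The input leaves no register free, but its matrix entries are bits: those in
   registers 2 to [n + 2] are first packed into register 2. *)
Fixpoint pack (n : nat) : cmd :=
  if n is n'.+1 then seqc [:: pack n'; CAdd 2 2 2; CAdd 2 2 n'.+3] else CSkip.

Lemma den_pack n s :
  vr (den (pack n) s) 2 = \sum_(l < n.+1) vr s (l + 2) * 2 ^ (n - l) /\
  (forall x, x != 2 -> vr (den (pack n) s) x = vr s x).
Proof.
elim: n => [|n [IH1 IH2]].
  by rewrite big_ord_recl big_ord0 /= muln1 addn0.
split=> [|x Hx].
  rewrite /= /upd /= IH1 IH2 // [RHS]big_ord_recr /= subnn muln1.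
  rewrite addn2; congr (_ + _).
  rewrite -big_split; apply: eq_bigr => l _ /=.
  by rewrite (@subSn l n) ?leq_ord // expnS mulnCA mul2n addnn.
by rewrite /= /upd /= (negPf Hx) IH2.
Qed.

Definition square := seqc [:: CConst 4 0; CRep 0 (CAdd 4 4 0)].

Definition shift_body := seqc
  [:: CSub 5 5 3; CGet 6 0 5; CPut 0 5 8; CAdd 7 5 9;
      CAdd 7 7 7; CAdd 7 7 7; CAdd 7 7 7; CPut 0 7 6].

Definition shift := seqc
  [:: CConst 8 0; CAdd 5 4 8; CConst 9 26; CRep 4 shift_body].

Definition power_loop := seqc
  [:: CConst 9 1; CConst 4 24; CRep 4 (CAdd 9 9 9)].

Definition unpack_body := seqc
  [:: CAdd 2 2 2; CSub 6 9 2;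
      CIf 6 CSkip (seqc [:: CSub 2 2 9; CPut 0 7 3]); CAdd 7 7 5].

(** The first address is [16 = 8 * 2], the new place of input register 2, where the matrix
    begins. *)
Definition unpack := seqc
  [:: CConst 7 16; CConst 5 8; CRep 4 unpack_body].

Definition relocate := seqc [:: CConst 3 1; square; shift; power_loop; unpack].

Lemma den_square s : vr (den square s) 4 = vr s 0 * vr s 0.
Proof.
rewrite /=; set s1 := State _ _.
pose I i s' := vr s' 0 = vr s 0 /\ vr s' 4 = i * vr s 0.
suff [] : I (vr s 0) (den (CRep 0 (CAdd 4 4 0)) s1) by [].
apply: (@den_rep I 0 _ s1) => // i s' _ [H0 H4]; split; rewrite /= /upd //=.
by rewrite H0 H4 mulSn addnC.
Qed.

(** The memory in the middle of the move: cells from [i] on have been moved, those below [i] are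
    untouched. *)
Definition spread (o : nat -> nat) (i j : nat) : nat :=
  if j < i then o j else
  if (8 %| j) && (26 + i <= j %/ 8) then o (j %/ 8 - 26) else 0.

(** The move is in place and therefore runs downwards: the target [8 * (26 + j)] of cell [j] lies
    above every cell still to be read. *)
Lemma den_shift s o : vr s 3 = 1 -> (forall j, ar s 0 j = o j) ->
  (forall j, vr s 4 <= j -> o j = 0) ->
  forall j, ar (den shift s) 0 j = spread o 0 j.
Proof.
move=> H3 Ho Hz; rewrite [den shift s]/=; set s1 := State _ _.
pose I i s' := [/\ vr s' 3 = 1, vr s' 8 = 0, vr s' 9 = 26, vr s' 5 = vr s 4 - i
  & forall j, ar s' 0 j = spread o (vr s 4 - i) j].
suff [_ _ _ _] : I (vr s 4) (den (CRep 4 shift_body) s1) by rewrite subnn.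
have s14 : vr s1 4 = vr s 4 by [].
rewrite -{1}s14.
apply: den_rep.
  split=> //=; rewrite /upd /= ?subn0 ?addn0 //.
  move=> j; rewrite Ho /spread; case: ltnP => // Hj.
  rewrite Hz //; case: ifP => // /andP[H1 H2]; rewrite Hz //; lia.
rewrite s14 => i s' Hi [E3 E8 E9 E5 Ea]; split=> //.
- by rewrite /= /upd /= E5 E3; lia.
- move=> j; set q := vr s 4 - i.+1.
  have Eq : vr s 4 - i = q.+1 by rewrite /q; lia.
  rewrite /= /upd /= E5 E3 E8 E9 !Ea Eq subn1 /=.
  rewrite /spread ltnSn.
  case: (j =P _) => Hj.
    rewrite (_ : (j < q) = false); last lia.
    by rewrite ifT; [congr o|]; lia.
  case: (j =P q) => Hjq.
    by rewrite Hjq ltnn ifF //; lia.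
  case: (ltnP j q) => H1; first by rewrite ltnS ltnW.
  rewrite ifF; last lia.
  by congr (if _ then _ else _); lia.
Qed.

Lemma den_doubling s : vr s 9 = 1 ->
  vr (den (CRep 4 (CAdd 9 9 9)) s) 9 = 2 ^ vr s 4.
Proof.
move=> H9; pose I i s' := vr s' 9 = 2 ^ i.
apply: (@den_rep I 4 _ s) => // i s' _; rewrite /I /= /upd /= => ->.
by rewrite expnS mul2n addnn.
Qed.

Lemma den_power_loop s : vr (den power_loop s) 9 = 2 ^ 24.
Proof. exact: (@den_doubling (den (CConst 4 24) (den (CConst 9 1) s))). Qed.

Lemma den_power_loop_count s : vr (den power_loop s) 4 = 24.
Proof.
exact: (@den_vr_frame (CRep 4 (CAdd 9 9 9))
  (den (CConst 4 24) (den (CConst 9 1) s)) 4 isT).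
Qed.

Lemma sum_bits_lt c (b : nat -> nat) : (forall l, b l <= 1) ->
  \sum_(l < c) b l * 2 ^ l < 2 ^ c.
Proof.
move=> Hb; elim: c => [|c IH]; first by rewrite big_ord0.
rewrite big_ord_recr /= expnS mul2n -addnn -addSn leq_add //.
by rewrite -[X in _ <= X]mul1n leq_mul.
Qed.

(** The number with binary digits [b i], ..., [b (c - 1)], most significant first. *)
Definition packed (b : nat -> nat) (c i : nat) : nat :=
  \sum_(l < c - i) b (c - l.+1) * 2 ^ l.

Lemma packedS b c i : i < c ->
  packed b c i = b i * 2 ^ (c - i.+1) + packed b c i.+1.
Proof.
move=> Hi; rewrite /packed -(subnSK Hi) big_ord_recr /= addnC.
by rewrite subnSK // subKn // ltnW.
Qed.

Lemma packed0 b c : packed b c 0 = \sum_(l < c) b l * 2 ^ (c.-1 - l).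
Proof.
rewrite /packed subn0 (reindex_inj rev_ord_inj) /=; apply: eq_bigr => l _.
congr (b _ * 2 ^ _); have := ltn_ord l; lia.
Qed.

(** Before each round the unread digits sit flush below [2 ^ c]. Doubling lifts the leading one to
    weight [2 ^ c], where a comparison detects it and a subtraction removes it. A digit 0 needs no
    write, its cell being 0 already. *)
Lemma den_unpack s b c : vr s 4 = c -> vr s 9 = 2 ^ c -> vr s 3 = 1 ->
  (forall l, b l <= 1) -> vr s 2 = packed b c 0 ->
  (forall l, l < c -> ar s 0 (8 * (l + 2)) = 0) ->
  forall j, ar (den unpack s) 0 j =
    if (8 %| j) && (2 <= j %/ 8 < 2 + c) then b (j %/ 8 - 2) else ar s 0 j.
Proof.
move=> H4 H9 H3 Hb H2 Hz; rewrite [den unpack s]/=; set s1 := State _ _.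
pose I i s' := [/\ vr s' 3 = 1 /\ vr s' 5 = 8, vr s' 9 = 2 ^ c,
  vr s' 7 = 8 * (i + 2), vr s' 2 = 2 ^ i * packed b c i
  & forall j, ar s' 0 j =
    if (8 %| j) && (2 <= j %/ 8 < 2 + i) then b (j %/ 8 - 2) else ar s 0 j].
have s14 : vr s1 4 = c by [].
suff [_ _ _ _] : I c (den (CRep 4 unpack_body) s1) by [].
rewrite -{1}s14.
apply: den_rep.
  split=> //=; first by rewrite /upd /= H2 mul1n.
  by move=> j; rewrite ifF //; lia.
rewrite s14 => i s' Hi [[E3 E5] E9 E7 E2 Ea].
have Hlt : 2 ^ i.+1 * packed b c i.+1 < 2 ^ c.
  have -> : 2 ^ c = 2 ^ i.+1 * 2 ^ (c - i.+1) by rewrite -expnD subnKC.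
  rewrite ltn_pmul2l ?expn_gt0 //.
  exact: (@sum_bits_lt _ (fun l => b (c - l.+1))).
have E2' : vr s' 2 + vr s' 2 = b i * 2 ^ c + 2 ^ i.+1 * packed b c i.+1.
  rewrite E2 packedS // addnn -mul2n mulnA -expnS mulnDr; congr (_ + _).
  by rewrite mulnCA -expnD subnKC.
have zi : ar s 0 (8 * (i + 2)) = 0 by exact: Hz.
rewrite /= /upd /= E9 E2'.
have [bi|bi] : b i = 0 \/ b i = 1 by have := Hb i; lia.
  rewrite bi mul0n add0n ifF ?subn_eq0; last lia.
  split=> //=; rewrite ?E7 ?E5; first lia.
  move=> j; rewrite Ea; case: (j =P 8 * (i + 2)) => Hj.
    by rewrite Hj ifF ?ifT ?zi; [rewrite -bi; congr b| |]; lia.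
  by congr (if _ then _ else _); lia.
rewrite bi mul1n ifT ?subn_eq0 ?leq_addr //.
split=> //=; rewrite ?E7 ?E5; [lia|by rewrite addKn|].
move=> j; rewrite E3; case: (j =P 8 * (i + 2)) => Hj.
  by rewrite Hj ifT; [rewrite -bi; congr b|]; lia.
by rewrite Ea; congr (if _ then _ else _); lia.
Qed.

Lemma den_seqc5 c1 c2 c3 c4 c5 s :
  den (seqc [:: c1; c2; c3; c4; c5]) s = den c5 (den c4 (den c3 (den c2 (den c1 s)))).
Proof. by []. Qed.

(* Cell [p] of the input ends up in cell [8 * p] of the memory above register 26. *)
Lemma den_relocate s (f : nat -> nat) :
  (forall p, f p.+2 <= 1) -> (forall p, (vr s 0 * vr s 0).+1 < p -> f p = 0) ->
  vr s 2 = \sum_(l < 24) f (l + 2) * 2 ^ (23 - l) ->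
  (forall i, ar s 0 i = f (26 + i)) ->
  forall i a, a < 8 -> ar (den relocate s) 0 (8 * i + a) =
    if (a == 0) && (1 < i) then f i else 0.
Proof.
move=> Hb Hz H2 Ha i a Ha8.
rewrite /relocate (@den_seqc5 (CConst 3 1) square shift power_loop unpack).
set s1 := den (CConst 3 1) s; set s2 := den square s1; set s3 := den shift s2.
set s4 := den power_loop s3.
have s23 : vr s2 3 = 1 by exact: (@den_vr_frame square s1 3 isT).
have s33 : vr s4 3 = 1.
  by rewrite /s4 (@den_vr_frame power_loop _ 3 isT) /s3 (@den_vr_frame shift _ 3 isT).
have s42 : vr s4 2 = vr s 2.
  rewrite /s4 (@den_vr_frame power_loop _ 2 isT) /s3 (@den_vr_frame shift _ 2 isT).
  by rewrite /s2 (@den_vr_frame square _ 2 isT).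
have s2a j : ar s2 0 j = f (26 + j).
  by rewrite /s2 den_ar_frame // Ha.
have s3a j : ar s3 0 j = spread (fun j => f (26 + j)) 0 j.
  apply: den_shift => // j'; rewrite den_square /s1 /= /upd /= => Hj.
  by apply: Hz; lia.
have s4a j : ar s4 0 j = spread (fun j => f (26 + j)) 0 j.
  by rewrite /s4 den_ar_frame.
have s44 : vr s4 4 = 24 by exact: den_power_loop_count.
pose b l := f l.+2; have Hpk : vr s4 2 = packed b 24 0.
  by rewrite s42 H2 packed0; apply: eq_bigr => l _; rewrite /b addn2.
have Hs4 l : l < 24 -> ar s4 0 (8 * (l + 2)) = 0.
  by move=> Hl; rewrite s4a /spread ltn0 ifF //; lia.
rewrite (den_unpack s44 (den_power_loop s3) s33 Hb Hpk Hs4) /b.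
rewrite s4a /spread ltn0 addn0.
case: (a =P 0) => [->|Ha0] /=; last by rewrite !ifF //; lia.
rewrite addn0 mulKn // dvdn_mulr //=.
case: ltnP => H1 /=; last by rewrite ifF //; lia.
by case: ltnP => H3; congr f; lia.
Qed.

(** * Cuts of prefixes *)

Section Cuts.

Variable G : sgraph.
Implicit Types (S : {set G}) (alpha : {ffun G -> 'I_#|G|}).

Definition cut S : nat :=
  \sum_(x : G) \sum_(y : G) ((x \in S) && (y \notin S) && adj x y).

Definition edges : nat :=
  \sum_(x : G) \sum_(y : G) (adj x y && (enum_rank y < enum_rank x)).

Lemma sum_interval n a b : b < n -> \sum_(i < n) (a < i <= b) = b - a.
Proof.
move=> Hb; suff -> : \sum_(i < n) (a < i <= b) = minn b n.-1 - a by lia.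
elim: n {Hb} => [|n IH]; first by rewrite big_ord0; lia.
by rewrite big_ord_recr /= IH; case: (_ && _) / idP; lia.
Qed.

Lemma double_edges (f : G -> nat) : injective f ->
  (\sum_(x : G) \sum_(y : G) (adj x y && (f x < f y))).*2
    = \sum_(x : G) \sum_(y : G) adj x y.
Proof.
move=> finj; rewrite -addnn {2}exchange_big /= -big_split; apply: eq_bigr => x _.
rewrite -big_split; apply: eq_bigr => y _ /=; rewrite [adj y x]adj_sym.
case: (ltngtP (f x) (f y)) => [_|_|/finj ->]; rewrite ?andbT ?andbF ?addn0 //.
by rewrite adj_irrefl.
Qed.

(** Any injective numbering orients each edge once: doubled, both sides count the ordered adjacent
    pairs. *)
Lemma edgesE (f : G -> nat) : injective f ->
  \sum_(x : G) \sum_(y : G) (adj x y && (f x < f y)) = edges.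
Proof.
move=> finj; apply: double_inj; rewrite double_edges // /edges.
rewrite [X in _ = X.*2]exchange_big /=.
rewrite -(@double_edges (fun x => enum_rank x)); last first.
  by move=> x y /val_inj /enum_rank_inj.
congr double; apply: eq_bigr => x _; apply: eq_bigr => y _.
by rewrite adj_sym.
Qed.

(** Double counting: an edge between positions [a < b] is cut by the prefixes of sizes [a + 1] to
    [b], which are [b - a] in number, one more than its net cost. *)
Lemma sum_cut_prefixes alpha : linear_arrangement alpha ->
  \sum_(i < #|G|) cut [set x | alpha x < i] = net_cost alpha + edges.
Proof.
move=> /injectiveP ainj.
rewrite -(@edgesE (fun x => alpha x)); last by move=> x y /val_inj /ainj.
rewrite /net_cost -big_split exchange_big; apply: eq_bigr => x _ /=.
rewrite exchange_big [X in _ = X + _]big_mkcond -big_split; apply: eq_bigr => y _ /=.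
under eq_bigr => i _ do rewrite !inE -leqNgt.
case: (boolP (adj x y)) => Hxy /=; last first.
  by rewrite big1 // => i _; rewrite andbF.
under eq_bigr => i _ do rewrite andbT.
by rewrite sum_interval //; case: ltnP; lia.
Qed.

Lemma sum_eq_inj (f : G -> nat) c : injective f -> \sum_(x : G) (f x == c) <= 1.
Proof.
move=> finj; case: (pickP (fun x => f x == c)) => [x /eqP Hx|H0]; last first.
  by rewrite big1 // => x _; rewrite H0.
rewrite (bigD1 x) //= Hx eqxx big1 // => y /eqP Hy.
by case: eqP => // E; case: Hy; apply: finj; rewrite E.
Qed.

Lemma sum_eq2_inj (f : G -> nat) c d : injective f ->
  \sum_(x : G) \sum_(y : G) (f x == c) * (f y == d) <= 1.
Proof.
move=> finj; under eq_bigr => x _ do rewrite -big_distrr.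
rewrite -big_distrl /= -[1]/(1 * 1); apply: leq_mul; exact: sum_eq_inj.
Qed.

(* Over a given gap there is at most one edge of length 1 and at most two of
   length 2; every other edge over the gap has net cost at least 2. *)
Lemma cut_prefix_le alpha i : linear_arrangement alpha ->
  (cut [set x | alpha x < i]).*2 <= net_cost alpha + 4.
Proof.
move=> /injectiveP ainj; have vinj : injective (fun x => alpha x : nat).
  by move=> x y /val_inj /ainj.
case: i => [|i].
  rewrite /cut big1 // => x _; rewrite big1 // => y _; by rewrite inE.
have B c d := sum_eq2_inj c d vinj.
pose T c d := \sum_(x : G) \sum_(y : G) ((alpha x == c :> nat) * (alpha y == d :> nat)).
(* Edges of length 1 and 2 fall short of 2 by 2 and by 1, hence the doubled first term. For [i = 0]
   the truncated [i.-1] only makes the right side larger. *)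
have : (cut [set x | alpha x < i.+1]).*2 <=
    net_cost alpha + ((T i i.+1).*2 + T i i.+2 + T i.-1 i.+1).
  pose t c d x y := (alpha x == c :> nat) * (alpha y == d :> nat).
  have -> : net_cost alpha + ((T i i.+1).*2 + T i i.+2 + T i.-1 i.+1) =
      \sum_(x : G) \sum_(y : G)
        ((if adj x y && (alpha x < alpha y) then alpha y - alpha x - 1 else 0) +
         (t i i.+1 x y + t i i.+1 x y + t i i.+2 x y + t i.-1 i.+1 x y)).
    rewrite -addnn /T /net_cost -!big_split; apply: eq_bigr => x _ /=.
    by rewrite big_mkcond -!big_split.
  rewrite /cut -mul2n big_distrr; apply: leq_sum => x _.
  rewrite big_distrr; apply: leq_sum => y _; rewrite /t.
  rewrite !inE -leqNgt; case: (adj x y) => /=; last by rewrite andbF.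
  rewrite andbT; move: (nat_of_ord (alpha x)) (nat_of_ord (alpha y)) => a b.
  case: ltnP => H1; case: ltnP => H2; case: ltnP => H3 //=; lia.
by move=> H; apply: leq_trans H _; rewrite leq_add2l; have := B i i.+1;
  have := B i i.+2; have := B i.-1 i.+1; rewrite -!/(T _ _); lia.
Qed.

(** * Paths through good sets *)

Definition good k S := (cut S).*2 <= k + 4.

(** Only good sets are extended, but the set reached may itself be bad. The value omits the cut of
    the last set, as the sum over proper prefixes does. *)
Inductive reach (k : nat) : {set G} -> nat -> Prop :=
| reach0 : reach k set0 0
| reachS S v x : reach k S x -> good k S -> v \notin S ->
    reach k (v |: S) (x + cut S).

(** Completeness of the pruning: by [cut_prefix_le] every prefix is good. *)
Lemma reach_arrangement k alpha : linear_arrangement alpha ->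
  net_cost alpha <= k -> reach k setT (net_cost alpha + edges).
Proof.
move=> la Hk; rewrite -sum_cut_prefixes //.
suff H i : i <= #|G| ->
    reach k [set x | alpha x < i] (\sum_(l < i) cut [set x | alpha x < l]).
  have <- : [set x | alpha x < #|G|] = setT.
    by apply/setP => x; rewrite !inE ltn_ord.
  exact: H.
elim: i => [|i IH] Hi.
  rewrite big_ord0 (_ : [set _ | _] = set0); first exact: reach0.
  by apply/setP => x; rewrite !inE.
have ainj : injective alpha by apply/injectiveP.
have /codomP[v Hv] : Ordinal Hi \in codom alpha.
  by apply: inj_card_onto => //; rewrite card_ord.
have Hvi : alpha v = i :> nat by rewrite -Hv.
have -> : [set x | alpha x < i.+1] = v |: [set x | alpha x < i].
  apply/setP => x; rewrite !inE ltnS leq_eqVlt; congr (_ || _).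
  rewrite -Hvi; apply/eqP/eqP => [/val_inj/ainj //|-> //].
rewrite big_ord_recr /=; apply: reachS; first exact/IH/ltnW.
  by apply: leq_trans (cut_prefix_le _ la) _; rewrite leq_add2r.
by rewrite inE Hvi ltnn.
Qed.

Lemma reach_seq k S x : reach k S x -> exists s : seq G,
  [/\ uniq s, S = [set y in s] &
      x = \sum_(i < size s) cut [set y in take i s]].
Proof.
elim=> {S x} [|S v x _ [s [us -> ->]] _ Hv].
  by exists [::]; rewrite big_ord0; split=> //; apply/setP => x; rewrite !inE.
exists (rcons s v); split.
- by rewrite rcons_uniq us andbT; rewrite inE in Hv.
- by apply/setP => y; rewrite !inE mem_rcons inE.
- rewrite size_rcons big_ord_recr /= -cats1 take_size_cat //; congr (_ + _).
  by apply: eq_bigr => i _; rewrite takel_cat // ltnW.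
Qed.

(** Soundness: the order in which the vertices enter is an arrangement whose prefixes are the sets
    on the path. *)
Lemma arrangement_of_reach k x : reach k setT x ->
  exists2 alpha : {ffun G -> 'I_#|G|}, linear_arrangement alpha &
    net_cost alpha + edges = x.
Proof.
move=> /reach_seq[s [us Hs ->]].
have ins y : y \in s by have := in_setT y; rewrite Hs inE.
have size_s : size s = #|G|.
  by rewrite -(card_uniqP us); apply: eq_card => y; rewrite ins inE.
have idx y : index y s < #|G| by rewrite -size_s index_mem.
pose alpha := [ffun y => Ordinal (idx y)] : {ffun G -> 'I_#|G|}.
have la : linear_arrangement alpha.
  apply/injectiveP => y z; rewrite !ffunE => /(congr1 val) /= E.
  exact: (index_inj y (ins y) (ins z) E).
exists alpha => //; rewrite -sum_cut_prefixes // size_s; apply: eq_bigr => i _.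
by congr cut; apply/setP => y; rewrite !inE ffunE /= in_take.
Qed.

(** * Counting good sets *)

(** Here [d] is the distance from [r] and the parent is a neighbour nearer to [r]; the strict
    decrease of [d] permits induction along the tree. *)
Lemma spanning_parent (r : G) : connected_graph G ->
  exists (f : G -> G) (d : G -> nat),
    forall v, v != r -> adj (f v) v /\ d (f v) < d v.
Proof.
move=> cG.
pose P v n := [exists t : n.-tuple G, path (@adj G) r t && (last r t == v)].
have exP v : exists n, P v n.
  have /connectP[p Hp Hl] := cG r v.
  by exists (size p); apply/existsP; exists (in_tuple p); rewrite Hp Hl eqxx.
pose d v := ex_minn (exP v).
have parent v : v != r -> exists u, adj u v && (d u < d v).
  rewrite /d => Hv; case: (ex_minnP (exP v)) => n /existsP[t].
  case: n t => [|n] t; first by rewrite tuple0 /= eq_sym (negPf Hv).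
  case/andP=> Hp Hl _.
  have size_t := size_tuple t.
  case/lastP: (tval t) Hp Hl size_t => [|p z] //.
  rewrite rcons_path last_rcons size_rcons => /andP[Hp Ha] /eqP Ez [sp].
  exists (last r p); rewrite -Ez Ha ltnS /=.
  case: ex_minnP => n' _; apply.
  by apply/existsP; exists (tcast sp (in_tuple p)); rewrite val_tcast Hp eqxx.
exists (fun v => odflt v [pick u | adj u v && (d u < d v)]), d => v Hv.
case: pickP => [u /andP[] //|H0]; have [u Hu] := parent v Hv.
by rewrite H0 in Hu.
Qed.

(* Along a spanning tree, a set is determined by the tree edges that it cuts and
   by its trace on the root. *)
Lemma card_good_le k : connected_graph G ->
  #|[set S | good k S]| <= #|[set D : {set G} | (#|D|).*2 <= k + 6]|.
Proof.
move=> cG; case: (pickP (predT : pred G)) => [r _|G0]; last first.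
  apply: subset_leq_card; apply/subsetP => S _; rewrite inE.
  by rewrite (_ : #|S| = 0) //; apply: eq_card0 => x; have := G0 x.
have [f [d Hfd]] := spanning_parent r cG.
pose D S := [set v | if v == r then r \in S else (v \in S) != (f v \in S)].
have Dinj : injective D.
  move=> S S' E; apply/setP => v; have [n] := ubnP (d v).
  elim: n v => // n IH v Hn.
  have /setP/(_ v) := E; rewrite !inE; case: eqP => [-> //|/eqP Hv].
  have [_ Hd] := Hfd v Hv; rewrite -(IH (f v)); last by lia.
  by case: (v \in S); case: (v \in S'); case: (f v \in S).
rewrite -(card_imset _ Dinj); apply: subset_leq_card.
apply/subsetP => _ /imsetP[S HS ->]; rewrite inE in HS; rewrite inE.
(* The root contributes the extra 1, which turns [k + 4] into [k + 6]. *)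
suff: #|D S| <= (cut S).+1 by move: HS; rewrite /good; lia.
rewrite -sum1_card (big_mkcond (fun v => v \in D S)) (bigD1 r) //= -(add1n (cut S)).
apply: leq_add; first by case: (r \in D S).
pose t x y : nat := (x != r) && (y == f x) && adj x y.
have tE x : x != r -> \sum_(y : G) t x y = 1.
  move=> Hx; rewrite (bigD1 (f x)) //= big1 ?addn0 => [|y Hy].
    by rewrite /t Hx eqxx adj_sym (proj1 (Hfd x Hx)).
  by rewrite /t (negPf Hy) andbF.
(* A vertex of [D S] other than [r] pays with the edge to its parent, which leaves [S] in one
   direction or the other. *)
apply: (@leq_trans (\sum_(x : G) \sum_(y : G)
    (((x \in S) && (y \notin S)) * t x y + ((y \in S) && (x \notin S)) * t x y))).
  rewrite big_mkcond; apply: leq_sum => x _; case: ifP => // Hx.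
  rewrite inE (negPf Hx); case: ifP => // HxS; rewrite -(tE x Hx).
  apply: leq_sum => y _; rewrite /t; case: (y =P f x) => [->|_]; last by rewrite andbF.
  by move: HxS; case: (x \in S); case: (f x \in S) => //=; rewrite ?mul1n ?addn0.
under eq_bigr => x _ do rewrite big_split.
rewrite big_split /= [X in _ + X <= _]exchange_big -big_split.
apply: leq_sum => x _; rewrite -big_split; apply: leq_sum => y _ /=.
rewrite /t [adj y x]adj_sym; case: (_ && _) => //=; case: (adj x y); rewrite ?andbF //.
rewrite !andbT !mul1n; case: (boolP (x == r)) => Hx; case: (boolP (y == r)) => Hy //=;
  try by case: (_ == _).
(* An edge charged from both ends would make them parents of each other, against the decrease of
   [d]. *)
case: eqP => [Ey|_]; case: eqP => [Ex|_] //.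
have [_] := Hfd x Hx; have [_] := Hfd y Hy; rewrite -Ex -Ey; lia.
Qed.

(* Binomial expansion of [(1 + 9) ^ n], with [9 ^ #|D| <= 3 ^ (k + 6)]. *)
Lemma card_small_sets k :
  #|[set D : {set G} | (#|D|).*2 <= k + 6]| * 9 ^ #|G| <= 10 ^ #|G| * 3 ^ (k + 6).
Proof.
rewrite -sum_nat_const.
apply: (@leq_trans (\sum_(D : {set G}) 9 ^ (#|G| - #|D|) * 3 ^ (k + 6))).
  rewrite big_mkcond; apply: leq_sum => D _; case: ifP => //.
  rewrite inE => HD; rewrite -{1}(subnK (max_card (mem D))) expnD leq_mul //.
  by rewrite -[9]/(3 ^ 2) -expnM leq_exp2l // mul2n.
rewrite -big_distrl leq_mul //=.
have := @bigA_distr nat 0 1 muln addn G (fun=> 1) (fun=> 9).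
rewrite prod_nat_const /= => ->; apply: leq_sum => D _.
rewrite (bigID (fun x => x \in D)) /= big1 => [|x ->//]; rewrite mul1n.
under eq_bigr => x Hx do rewrite (negPf Hx).
rewrite prod_nat_const -(cardC (mem D)) addKn.
by rewrite leq_pexp2l // subset_leq_card //; apply/subsetP => x.
Qed.

Lemma card_good k : connected_graph G ->
  #|[set S | good k S]| * 9 ^ #|G| <= 10 ^ #|G| * 3 ^ (k + 6).
Proof.
move=> cG; apply: leq_trans (card_small_sets k).
by rewrite leq_mul2r card_good_le // orbT.
Qed.

End Cuts.

(** * Breadth-first search over vertex sets *)

Lemma den_cons c cs s : den (seqc (c :: cs)) s = den (seqc cs) (den c s).
Proof. by []. Qed.

Lemma den_nil s : den (seqc [::]) s = s.
Proof. by []. Qed.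

Lemma den_add_vr x y z s : vr (den (CAdd x y z) s) x = vr s y + vr s z.
Proof. by rewrite /= /upd eqxx. Qed.

(** Variables 0 and 1 are the input and output registers of the machine, so [n] and [k] are found,
    and the answer is left, in place. *)
Local Notation vN := 0 (only parsing).
Local Notation vK := 1 (only parsing).
Local Notation vOne := 3 (only parsing).
Local Notation vPtr := 4 (only parsing).
Local Notation vEdges := 5 (only parsing).
Local Notation vPow := 6 (only parsing).
Local Notation vHead := 7 (only parsing).
Local Notation vTail := 8 (only parsing).
Local Notation vCount := 9 (only parsing).
Local Notation vMask := 10 (only parsing).
Local Notation vRest := 11 (only parsing).
Local Notation vU := 12 (only parsing).
Local Notation vV := 13 (only parsing).
Local Notation vTmp := 14 (only parsing).
Local Notation vBit := 15 (only parsing).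
Local Notation vCut := 16 (only parsing).
Local Notation vVal := 17 (only parsing).
Local Notation vThr := 18 (only parsing).

Local Notation aAdj := 0 (only parsing).
Local Notation aVal := 1 (only parsing).
Local Notation aQueue := 2 (only parsing).
Local Notation aBit := 3 (only parsing).
Local Notation aPow := 4 (only parsing).

(* A set is coded by its bit mask; [aVal] holds one plus the best sum of cuts found
   so far for a mask, and 0 for a mask not yet reached. *)
Definition pow_body := seqc
  [:: CPut aPow vU vPow; CAdd vPow vPow vPow; CAdd vU vU vOne].
Definition pow_loop := seqc [:: CConst vPow 1; CConst vU 0; CRep vN pow_body].

Definition edge_body := seqc
  [:: CGet vBit aAdj vPtr; CAdd vPtr vPtr vOne; CSub vTmp vU vV;
      CIf vTmp (CAdd vEdges vEdges vBit) CSkip; CAdd vV vV vOne].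
Definition edge_row := seqc
  [:: CConst vV 0; CRep vN edge_body; CAdd vU vU vOne].
Definition edge_loop := seqc
  [:: CConst vU 0; CConst vPtr 2; CConst vEdges 0; CRep vN edge_row].

Definition decode_body := seqc
  [:: CSub vV vV vOne; CGet vBit aPow vV; CSub vTmp vBit vRest;
      CIf vTmp (seqc [:: CConst vTmp 0; CPut aBit vV vTmp])
               (seqc [:: CSub vRest vRest vBit; CPut aBit vV vOne])].
Definition decode := seqc
  [:: CConst vTmp 0; CAdd vRest vMask vTmp; CAdd vV vN vTmp;
      CRep vN decode_body].

Definition cut_body := seqc
  [:: CIf vBit
        (seqc [:: CGet vTmp aBit vV;
                  CIf vTmp CSkip
                    (seqc [:: CGet vTmp aAdj vPtr; CAdd vCut vCut vTmp])])
        CSkip;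
      CAdd vV vV vOne; CAdd vPtr vPtr vOne].
Definition cut_row := seqc
  [:: CGet vBit aBit vU; CConst vV 0; CRep vN cut_body; CAdd vU vU vOne].
Definition cut_loop := seqc
  [:: CConst vCut 0; CConst vPtr 2; CConst vU 0; CRep vN cut_row].

Definition push_body := seqc
  [:: CGet vBit aBit vV;
      CIf vBit CSkip
        (seqc [:: CGet vRest aPow vV; CAdd vRest vRest vMask;
                  CGet vTmp aVal vRest;
                  CIf vTmp
                    (seqc [:: CSub vBit vTmp vVal;
                              CIf vBit (CPut aVal vRest vVal) CSkip])
                    (seqc [:: CPut aVal vRest vVal; CPut aQueue vTail vRest;
                              CAdd vTail vTail vOne])]);
      CAdd vV vV vOne].
Definition push := seqc
  [:: CGet vVal aVal vMask; CAdd vVal vVal vCut; CConst vV 0;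
      CRep vN push_body].

(** Pruning takes place at expansion: a bad set may be queued, but nothing is pushed from it. *)
Definition visit := seqc
  [:: CGet vMask aQueue vHead; CAdd vHead vHead vOne; decode; cut_loop;
      CAdd vTmp vCut vCut; CSub vTmp vTmp vThr; CIf vTmp CSkip push].

Definition layer := seqc [:: CSub vCount vTail vHead; CRep vCount visit].

(** The queue needs no write: its cell 0 already holds 0, the code of the empty set. [vHead], being
    0, also serves as that code when the table is initialised. *)
Definition start := seqc
  [:: CConst vOne 1; CConst vTmp 4; CAdd vThr vK vTmp; pow_loop; edge_loop;
      CConst vHead 0; CConst vTail 1; CPut aVal vHead vOne].

(** The full set has mask [2 ^ n - 1]. Its entry exceeds the net cost by 1 and the number of edges;
    an entry 0 means that no path reaches it. *)
Definition finish := seqc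
  [:: CSub vPow vPow vOne; CGet vTmp aVal vPow;
      CIf vTmp
        (seqc [:: CSub vTmp vTmp vOne; CSub vTmp vTmp vEdges;
                  CSub vBit vTmp vK;
                  CIf vBit (CConst vN 0)
                    (seqc [:: CConst vN 0; CAdd vK vTmp vN; CConst vN 1])])
        (CConst vN 0)].

Definition search := seqc [:: start; CRep vN layer; finish].

(** * Loops for powers of two, edges, binary digits and cuts *)

Lemma den_pow_loop s : vr s vOne = 1 ->
  vr (den pow_loop s) vPow = 2 ^ vr s vN /\
  (forall i, i < vr s vN -> ar (den pow_loop s) aPow i = 2 ^ i).
Proof.
move=> H1; rewrite /pow_loop 3!den_cons den_nil; set s1 := den _ (den _ s).
pose I i s' := [/\ vr s' vOne = 1, vr s' vPow = 2 ^ i, vr s' vU = i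
  & forall j, j < i -> ar s' aPow j = 2 ^ j].
suff [] : I (vr s vN) (den (CRep vN pow_body) s1) by [].
have <- : vr s1 vN = vr s vN by [].
apply: den_rep => // i s' _ [E1 EP EU EA].
split; rewrite /= /upd /= ?EU ?E1 ?EP ?addn1 //.
  by rewrite addnn -mul2n expnS.
by move=> j; rewrite ltnS leq_eqVlt; case: eqP => [->|_] //= /EA.
Qed.

Lemma den_edge_row s : vr s vOne = 1 ->
  vr (den edge_row s) vEdges = vr s vEdges
    + \sum_(v < vr s vN) (if v < vr s vU then ar s aAdj (vr s vPtr + v) else 0)
  /\ vr (den edge_row s) vPtr = vr s vPtr + vr s vN.
Proof.
move=> H1; rewrite /edge_row 3!den_cons den_nil; set s1 := den _ s.
pose I i s' := [/\ vr s' vOne = 1, vr s' vU = vr s vU, vr s' vV = i,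
    vr s' vPtr = vr s vPtr + i & ar s' aAdj = ar s aAdj /\
  vr s' vEdges = vr s vEdges
    + \sum_(v < i) (if v < vr s vU then ar s aAdj (vr s vPtr + v) else 0)].
suff [_ _ _ EP [_ EM]] : I (vr s vN) (den (CRep vN edge_body) s1) by split.
have <- : vr s1 vN = vr s vN by [].
apply: den_rep.
  by split; rewrite /= /upd /= ?addn0 // big_ord0 addn0.
move=> i s' _ [E1 EU EV EP [EA EM]].
rewrite /I /= /upd /= EU EV EP EA E1 big_ord_recr /= subn_eq0.
by case: leqP => Hi; split; rewrite /= /upd /= ?EU ?EV ?EP ?E1 ?addn1 ?addnS //;
  rewrite ?EM ?addn0 ?addnA.
Qed.

Lemma den_edge_loop s : vr s vOne = 1 ->
  vr (den edge_loop s) vEdges = \sum_(u < vr s vN) \sum_(v < vr s vN)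
    (if v < u then ar s aAdj (u * vr s vN + v + 2) else 0).
Proof.
move=> H1; rewrite /edge_loop 4!den_cons den_nil; set s1 := den _ (den _ (den _ s)).
pose n := vr s vN.
pose I i s' := [/\ vr s' vN = n /\ vr s' vOne = 1, vr s' vU = i,
  vr s' vPtr = i * n + 2, ar s' aAdj = ar s aAdj
  & vr s' vEdges = \sum_(u < i) \sum_(v < n)
    (if v < u then ar s aAdj (u * n + v + 2) else 0)].
suff [_ _ _ _ ->] : I n (den (CRep vN edge_row) s1) by [].
have <- : vr s1 vN = n by [].
apply: den_rep; first by split; rewrite ?big_ord0.
move=> i s' _ [[EN E1] EU EP EA EM].
have [HM HP] := den_edge_row E1.
split; rewrite ?HP ?HM ?EN ?EP ?EM.
- by rewrite !(@den_vr_frame edge_row).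
- rewrite /edge_row 3!den_cons den_nil /= /upd /=.
  rewrite -/(den (CRep vN edge_body) _) !(@den_vr_frame (CRep vN edge_body)) //=.
  by rewrite /upd /= EU E1 addn1.
- by rewrite mulSn; lia.
- by rewrite (@den_ar_frame edge_row).
- rewrite big_ord_recr /= EU EA; congr (_ + _); apply: eq_bigr => v _.
  by rewrite addnAC.
Qed.

(** Digits are read from the top: those below [q] sum to less than [2 ^ q], so comparing the
    remainder with [2 ^ q] decides digit [q]. *)
Lemma den_decode s (b : nat -> bool) : vr s vOne = 1 ->
  (forall i, i < vr s vN -> ar s aPow i = 2 ^ i) ->
  vr s vMask = \sum_(i < vr s vN) b i * 2 ^ i ->
  forall i, i < vr s vN -> ar (den decode s) aBit i = b i.
Proof.
move=> H1 HP HM; rewrite /decode 4!den_cons den_nil.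
set s1 := den _ (den _ (den _ s)).
pose n := vr s vN.
pose I i s' := [/\ vr s' vOne = 1, ar s' aPow = ar s aPow, vr s' vV = n - i,
  vr s' vRest = \sum_(l < n - i) b l * 2 ^ l
  & forall j, n - i <= j -> j < n -> ar s' aBit j = b j].
suff [_ _ _ _ Hb] : I n (den (CRep vN decode_body) s1).
  by move=> i Hi; apply: Hb; rewrite ?subnn.
have <- : vr s1 vN = n by [].
apply: den_rep.
  split; rewrite /= /upd /= ?addn0 ?subn0 //.
  by move=> j H3 H4; lia.
rewrite (_ : vr s1 vN = n) // => i s' Hi [E1 EP EV ER EB].
set q := n - i.+1; have Eq : n - i = q.+1 by rewrite /q; lia.
have Hq : q < n by rewrite /q; lia.
rewrite Eq in EV ER EB.
have lt : \sum_(l < q) b l * 2 ^ l < 2 ^ q by apply: (@sum_bits_lt q b) => l; case: (b l).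
move: ER; rewrite big_ord_recr /= => ER.
have EBq t j (f : nat -> nat) : q <= j -> j < n -> t = b q :> nat ->
    f =1 ar s' aBit -> upd f q t j = b j.
  rewrite /upd; case: eqP => [-> _ _ ->//|Hj Hqj Hjn _ Ef].
  by rewrite Ef EB //; lia.
rewrite /I -/q /= /upd /= E1 EV subn1 /= EP HP // ER.
case Eb: (b q); rewrite ?mul1n ?mul0n ?addn0.
  rewrite ifT; last by rewrite subn_eq0 leq_addl.
  split=> //=; rewrite ?addnK // => j Hqj Hjn.
  by rewrite -[if _ then _ else _]/(upd (ar s' aBit) q 1 j) EBq // Eb.
rewrite ifF; last by rewrite subn_eq0 leqNgt lt.
split=> //=; first by rewrite ER Eb mul0n addn0.
move=> j Hqj Hjn.
by rewrite -[if _ then _ else _]/(upd (ar s' aBit) q 0 j) EBq // Eb.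
Qed.

Lemma den_cut_row s : vr s vOne = 1 ->
  vr (den cut_row s) vCut = vr s vCut + \sum_(v < vr s vN)
    (if (ar s aBit (vr s vU) != 0) && (ar s aBit v == 0)
     then ar s aAdj (vr s vPtr + v) else 0)
  /\ vr (den cut_row s) vPtr = vr s vPtr + vr s vN.
Proof.
move=> H1; rewrite /cut_row 4!den_cons den_nil; set s1 := den _ (den _ s).
pose n := vr s vN.
pose F v := if (ar s aBit (vr s vU) != 0) && (ar s aBit v == 0)
     then ar s aAdj (vr s vPtr + v) else 0.
pose I i s' := [/\ vr s' vOne = 1, vr s' vBit = ar s aBit (vr s vU),
  vr s' vV = i /\ vr s' vPtr = vr s vPtr + i,
  ar s' aAdj = ar s aAdj /\ ar s' aBit = ar s aBit
  & vr s' vCut = vr s vCut + \sum_(v < i) F v].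
suff [_ _ [_ EP] _ EM] : I n (den (CRep vN cut_body) s1) by split.
have <- : vr s1 vN = n by [].
apply: den_rep; first by split; rewrite /= /upd /= ?addn0 // big_ord0 addn0.
move=> i s' _ [E1 EB [EV EP] [EA EBit] EM].
rewrite /I big_ord_recr /= /upd /= EB EV EBit [F i]/F.
case: (ar s aBit (vr s vU) =P 0) => HU; rewrite /= /upd /=.
  by rewrite EV EP E1 !addn1 addnS addn0 EM.
case: (ar s aBit i =P 0) => HV; rewrite /= /upd /=.
  by rewrite EV EP E1 EA EM !addn1 addnS !addnA.
by rewrite EV EP E1 !addn1 addnS addn0 EM.
Qed.

(** The matrix is read in storage order by a pointer that starts at 2, after the registers of [n]
    and [k]; no product [u * n] is ever computed. *)
Lemma den_cut_loop s : vr s vOne = 1 ->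
  vr (den cut_loop s) vCut = \sum_(u < vr s vN) \sum_(v < vr s vN)
    (if (ar s aBit u != 0) && (ar s aBit v == 0)
     then ar s aAdj (u * vr s vN + v + 2) else 0).
Proof.
move=> H1; rewrite /cut_loop 4!den_cons den_nil; set s1 := den _ (den _ (den _ s)).
pose n := vr s vN.
pose I i s' := [/\ vr s' vN = n /\ vr s' vOne = 1, vr s' vU = i,
  vr s' vPtr = i * n + 2, ar s' aAdj = ar s aAdj /\ ar s' aBit = ar s aBit
  & vr s' vCut = \sum_(u < i) \sum_(v < n)
    (if (ar s aBit u != 0) && (ar s aBit v == 0)
     then ar s aAdj (u * n + v + 2) else 0)].
suff [_ _ _ _ ->] : I n (den (CRep vN cut_row) s1) by [].
have <- : vr s1 vN = n by [].
apply: den_rep; first by split; rewrite ?big_ord0.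
move=> i s' _ [[EN E1] EU EP [EA EB] EM].
have [HM HP] := den_cut_row E1.
split; rewrite ?HP ?HM ?EN ?EP ?EM.
- by rewrite !(@den_vr_frame cut_row).
- rewrite /cut_row 4!den_cons den_nil /= /upd /=.
  rewrite -/(den (CRep vN cut_body) _) !(@den_vr_frame (CRep vN cut_body)) //=.
  by rewrite /upd /= EU E1 addn1.
- by rewrite mulSn; lia.
- by rewrite !(@den_ar_frame cut_row).
- rewrite big_ord_recr /= EU EA EB; congr (_ + _); apply: eq_bigr => v _.
  by rewrite addnAC.
Qed.

(** * Bit masks and the search invariant *)

Section Search.

Variables (G : sgraph) (k : nat).
Implicit Types (S T : {set G}) (x : G).

Lemma sum_enum_rank (F : 'I_#|G| -> nat) :
  \sum_(i < #|G|) F i = \sum_(x : G) F (enum_rank x).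
Proof. by rewrite (reindex _ (onW_bij _ (@enum_rank_bij G))). Qed.

Definition code S : nat := \sum_(x in S) 2 ^ enum_rank x.

Definition bit S (i : nat) : bool := [exists x in S, enum_rank x == i :> nat].

Lemma bit_rank S x : bit S (enum_rank x) = (x \in S).
Proof.
apply/existsP/idP => [[y /andP[Hy /eqP/val_inj/enum_rank_inj <-]] //|Hx].
by exists x; rewrite Hx eqxx.
Qed.

Lemma codeE S : code S = \sum_(i < #|G|) bit S i * 2 ^ i.
Proof.
rewrite sum_enum_rank /code big_mkcond; apply: eq_bigr => x _.
by rewrite bit_rank; case: (x \in S); rewrite ?mul1n ?mul0n.
Qed.

Lemma sum_bits_inj n (b c : nat -> bool) :
  \sum_(i < n) b i * 2 ^ i = \sum_(i < n) c i * 2 ^ i ->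
  forall i, i < n -> b i = c i.
Proof.
have lt (d : nat -> bool) m : \sum_(l < m) d l * 2 ^ l < 2 ^ m.
  by apply: (@sum_bits_lt m d) => l; case: (d l).
elim: n => // n IH; rewrite !big_ord_recr /= => E.
have Ebc : b n = c n.
  by move: E (lt b n) (lt c n); case: (b n); case: (c n) => //=; lia.
move: E; rewrite Ebc => /eqP; rewrite eqn_add2r => /eqP /IH {}IH i.
by rewrite ltnS leq_eqVlt => /orP[/eqP ->|/IH].
Qed.

Lemma code_inj : injective code.
Proof.
move=> S T; rewrite !codeE => /sum_bits_inj E; apply/setP => x.
by have := E _ (ltn_ord (enum_rank x)); rewrite !bit_rank.
Qed.

Lemma code0 : code set0 = 0.
Proof. by rewrite /code big_set0. Qed.

Lemma codeU1 S x : x \notin S -> code (x |: S) = 2 ^ enum_rank x + code S.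
Proof. by move=> Hx; rewrite /code big_setU1. Qed.

Lemma codeT : code setT = 2 ^ #|G| - 1.
Proof.
have bT (i : 'I_#|G|) : bit setT i by rewrite -(enum_valK i) bit_rank in_setT.
rewrite codeE; under eq_bigr => i _ do rewrite bT mul1n.
elim: #|G| => [|n IH]; first by rewrite big_ord0.
by rewrite big_ord_recr /= IH expnS; have := expn_gt0 2 n; lia.
Qed.

Definition val_of (s : state) S : nat := ar s aVal (code S).

(** [q] is a ghost list of all sets ever queued and is never shortened, so its members are exactly
    the sets with a table entry. Each entry is realised by a path; minimality is left to
    [at_layer]. *)
Record inv (q : seq {set G}) (s : state) : Prop := Inv {
  inv_n : vr s vN = #|G|;
  inv_one : vr s vOne = 1;
  inv_thr : vr s vThr = k + 4;
  inv_pow : forall i, i < #|G| -> ar s aPow i = 2 ^ i;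
  inv_adj : forall x y, ar s aAdj (enum_rank x * #|G| + enum_rank y + 2) = adj x y;
  inv_tail : vr s vTail = size q;
  inv_queue : forall i, i < size q -> ar s aQueue i = code (nth set0 q i);
  inv_uniq : uniq q;
  inv_mem : forall S, (S \in q) = (val_of s S != 0);
  inv_reach : forall S, S \in q -> reach k S (val_of s S).-1 }.

Lemma inv_eq q s s' : inv q s ->
  vr s' vN = vr s vN -> vr s' vOne = vr s vOne -> vr s' vThr = vr s vThr ->
  vr s' vTail = vr s vTail ->
  (forall a, a \in [:: aAdj; aVal; aQueue; aPow] -> ar s' a = ar s a) ->
  inv q s'.
Proof.
case=> H1 H2 H3 H4 H5 H6 H7 H8 H9 H10 E0 E1 E2 E3 EA.
by split; rewrite /val_of ?E0 ?E1 ?E2 ?E3 // => *; rewrite EA //; auto.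
Qed.

(** The effect of expanding sets of cardinality [j - 1]. Values outside cardinality [j] stay fixed,
    so the layer being read is stable, and no known value rises, so bounds once obtained persist. *)
Definition extends j q s q1 s' : Prop :=
  [/\ inv (q ++ q1) s', forall T, T \in q1 -> #|T| = j,
      forall T, #|T| != j -> val_of s' T = val_of s T
    & forall T, T \in q -> val_of s' T <= val_of s T].

Lemma extends_inv j q s s' : inv q s' -> ar s' aVal = ar s aVal ->
  extends j q s [::] s'.
Proof. by move=> Hi E; split; rewrite ?cats0 // /val_of => *; rewrite E. Qed.

Lemma extends_trans j q s q1 s1 q2 s2 : extends j q s q1 s1 ->
  extends j (q ++ q1) s1 q2 s2 -> extends j q s (q1 ++ q2) s2.
Proof.
move=> [_ A1 B1 C1] [I2 A2 B2 C2]; split.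
- by rewrite catA.
- by move=> T; rewrite mem_cat => /orP[/A1|/A2].
- by move=> T HT; rewrite B2 // B1.
- by move=> T HT; rewrite (leq_trans (C2 T _)) ?C1 // mem_cat HT.
Qed.

Lemma val_of_upd s s' T g : ar s' aVal =1 upd (ar s aVal) (code T) g ->
  forall T', val_of s' T' = if T' == T then g else val_of s T'.
Proof. by move=> E T'; rewrite /val_of E /upd (inj_eq code_inj). Qed.

Lemma inv_lower q s s' T g : inv q s -> T \in q -> 0 < g <= val_of s T ->
  reach k T g.-1 ->
  vr s' vN = vr s vN -> vr s' vOne = vr s vOne -> vr s' vThr = vr s vThr ->
  vr s' vTail = vr s vTail ->
  (forall a, a \in [:: aAdj; aQueue; aPow] -> ar s' a = ar s a) ->
  ar s' aVal =1 upd (ar s aVal) (code T) g ->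
  extends #|T| q s [::] s'.
Proof.
case=> H1 H2 H3 H4 H5 H6 H7 H8 H9 H10 Tq /andP[g0 gT] rT E0 E1 E2 E3 EA EV.
have Ev := val_of_upd EV.
split=> //.
- rewrite cats0; split; rewrite ?E0 ?E1 ?E2 ?E3 //; try by move=> *; rewrite EA //; auto.
  + by move=> T'; rewrite Ev; case: (T' =P T) => [->|_]; [rewrite Tq -lt0n g0|exact: H9].
  + by move=> T' HT'; rewrite Ev; case: (T' =P T) => [->|_] //; exact: H10.
- by move=> T' HT'; rewrite Ev; case: (T' =P T) => // E; rewrite E eqxx in HT'.
- by move=> T' HT'; rewrite Ev; case: (T' =P T) => // ->.
Qed.

Lemma inv_push q s s' T g : inv q s -> T \notin q -> 0 < g -> reach k T g.-1 ->
  vr s' vN = vr s vN -> vr s' vOne = vr s vOne -> vr s' vThr = vr s vThr ->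
  vr s' vTail = (vr s vTail).+1 ->
  (forall a, a \in [:: aAdj; aPow] -> ar s' a = ar s a) ->
  ar s' aVal =1 upd (ar s aVal) (code T) g ->
  ar s' aQueue =1 upd (ar s aQueue) (vr s vTail) (code T) ->
  extends #|T| q s [:: T] s'.
Proof.
case=> H1 H2 H3 H4 H5 H6 H7 H8 H9 H10 Tq g0 rT E0 E1 E2 E3 EA EV EQ.
have Ev := val_of_upd EV.
have Tneq T' : T' \in q -> (T' == T) = false.
  by move=> HT'; apply/eqP => E; rewrite -E HT' in Tq.
split.
- rewrite cats1; split; rewrite ?E0 ?E1 ?E2 ?E3 //; try by move=> *; rewrite EA //; auto.
  + by rewrite size_rcons H6.
  + move=> i; rewrite size_rcons ltnS nth_rcons EQ /upd H6.
    by case: ltngtP => // Hi _; rewrite H7.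
  + by rewrite rcons_uniq Tq.
  + move=> T'; rewrite mem_rcons inE Ev; case: (T' =P T) => [->|_] /=; last exact: H9.
    by rewrite -lt0n g0.
  + move=> T'; rewrite mem_rcons inE Ev; case: (T' =P T) => [->|_] //=; exact: H10.
- by move=> T'; rewrite inE => /eqP ->.
- by move=> T' HT'; rewrite Ev; case: (T' =P T) => // E; rewrite E eqxx in HT'.
- by move=> T' HT'; rewrite Ev Tneq.
Qed.

Lemma den_push_body_index s : vr s vOne = 1 ->
  vr (den push_body s) vV = (vr s vV).+1.
Proof.
move=> H1; rewrite /push_body 3!den_cons den_nil den_add_vr !den_vr_frame //.
by rewrite H1 addn1.
Qed.

Lemma den_push_body q s S x g : inv q s -> vr s vMask = code S ->
  vr s vV = enum_rank x -> ar s aBit (enum_rank x) = (x \in S) ->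
  vr s vVal = g -> 0 < g -> (x \notin S -> reach k (x |: S) g.-1) ->
  exists q1, extends #|S|.+1 q s q1 (den push_body s) /\
    (x \notin S -> x |: S \in q ++ q1 /\ val_of (den push_body s) (x |: S) <= g).
Proof.
move=> Iq EM EV EB EG g0 Hr.
case: (boolP (x \in S)) => Hx.
  exists [::]; split=> //; apply: extends_inv.
    apply: inv_eq Iq _ _ _ _ _ => //=; by rewrite /upd /= EV EB Hx.
  by rewrite /= /upd /= EV EB Hx.
set T := x |: S; have cT : code T = 2 ^ enum_rank x + code S by rewrite codeU1.
have cardT : #|T| = #|S|.+1 by rewrite cardsU1 Hx.
rewrite -cardT.
have Epow : ar s aPow (vr s vV) = 2 ^ enum_rank x by rewrite EV (inv_pow Iq).
case: (boolP (T \in q)) => HT.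
  have vT0 : (ar s aVal (code T) == 0) = false.
    by apply/negbTE; move: HT; rewrite (inv_mem Iq).
  have [Hle|Hlt] := leqP (val_of s T) g.
    have [D DT] : ar (den push_body s) = ar s /\ vr (den push_body s) vTail = vr s vTail.
      rewrite /= /upd /= EV EB (negPf Hx) /= /upd /= -EV Epow EM -cT vT0 /= /upd /= EG.
      by rewrite (_ : ar s aVal (code T) - g == 0) //= subn_eq0.
    exists [::]; split.
      apply: extends_inv; last by rewrite D.
      by apply: inv_eq Iq _ _ _ _ _; rewrite ?D // den_vr_frame.
    by rewrite cats0 /val_of D.
  have [DA DT] : ar (den push_body s) = (fun b => if b == aVal then
       upd (ar s aVal) (code T) g else ar s b) /\ vr (den push_body s) vTail = vr s vTail.
    rewrite /= /upd /= EV EB (negPf Hx) /= /upd /= -EV Epow EM -cT vT0 /= /upd /= EG.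
    rewrite (_ : (ar s aVal (code T) - g == 0) = false) //=.
    by rewrite subn_eq0 leqNgt Hlt.
  exists [::]; split.
    apply: (@inv_lower q s _ T g) => //; rewrite ?g0 1?ltnW //; try exact: Hr;
      rewrite ?den_vr_frame //; try by rewrite DA.
    by move=> a; rewrite !inE DA => /or3P[] /eqP ->.
  by rewrite cats0 HT /val_of DA /= /upd eqxx.
have vT0 : ar s aVal (code T) = 0.
  by apply/eqP; apply: contraNT HT; rewrite (inv_mem Iq).
have [DA DT] : ar (den push_body s) = (fun b => if b == aQueue then
     upd (ar s aQueue) (vr s vTail) (code T) else if b == aVal then
     upd (ar s aVal) (code T) g else ar s b)
   /\ vr (den push_body s) vTail = (vr s vTail).+1.
  rewrite /= /upd /= EV EB (negPf Hx) /= /upd /= -EV Epow EM -cT vT0 /= /upd /= EG.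
  by rewrite (inv_one Iq) addn1.
exists [:: T]; split.
  apply: (@inv_push q s _ T g) => //; try exact: Hr;
    rewrite ?den_vr_frame //; try by rewrite DA.
  by move=> a; rewrite !inE DA => /orP[] /eqP ->.
by rewrite mem_cat inE eqxx orbT /val_of DA /= /upd eqxx.
Qed.

Lemma inv_gt0 q s S : inv q s -> S \in q -> 0 < val_of s S.
Proof. by move=> Iq; rewrite (inv_mem Iq) lt0n. Qed.

Lemma den_push q s S : inv q s -> S \in q -> vr s vMask = code S ->
  (forall i, i < #|G| -> ar s aBit i = bit S i) -> vr s vCut = cut S ->
  good k S -> exists q1, extends #|S|.+1 q s q1 (den push s) /\
    forall x, x \notin S -> x |: S \in q ++ q1 /\
      val_of (den push s) (x |: S) <= val_of s S + cut S.
Proof.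
move=> Iq Sq EM EB EC gS; rewrite /push 4!den_cons den_nil.
set s1 := den _ (den _ (den _ s)).
set g := val_of s S + cut S.
have v0 := inv_gt0 Iq Sq.
have Hr x : x \notin S -> reach k (x |: S) g.-1.
  (* Entries carry an extra 1, so a positive [val_of s S] is needed here. *)
  move=> Hx; rewrite (_ : g.-1 = (val_of s S).-1 + cut S); last by rewrite /g; lia.
  by apply: reachS => //; exact: (inv_reach Iq).
have I1 : inv q s1 by exact: inv_eq Iq _ _ _ _ _.
pose I i s' := exists q1, [/\ extends #|S|.+1 q s q1 s',
  vr s' vMask = code S /\ vr s' vVal = g, ar s' aBit = ar s aBit, vr s' vV = i
  & forall x, enum_rank x < i -> x \notin S ->
      x |: S \in q ++ q1 /\ val_of s' (x |: S) <= g].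
suff [q1 [E _ _ _ H]] : I #|G| (den (CRep vN push_body) s1).
  by exists q1; split=> // x Hx; apply: H.
rewrite -(inv_n I1); apply: den_rep.
  exists [::]; split=> //; first exact: extends_inv.
  by rewrite /= /upd /= EM /g EC.
rewrite (inv_n I1) => i s' Hi [q1 [E [EM' EG] EB' EV H]].
pose x := enum_val (Ordinal Hi).
have rx : enum_rank x = i :> nat by rewrite enum_valK.
have [I' _ _ _] := E.
have [|||q2 [E2 H2]] := @den_push_body _ s' S x g I' EM' _ _ EG _ (Hr x).
- by rewrite rx.
- by rewrite EB' EB // bit_rank.
- by rewrite /g; lia.
exists (q1 ++ q2); split.
- exact: extends_trans E E2.
- by rewrite !(@den_vr_frame push_body).
- by rewrite (@den_ar_frame push_body).
- by rewrite den_push_body_index ?(inv_one I') // EV.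
move=> y; rewrite ltnS leq_eqVlt catA => /orP[/eqP Hy|Hy] HyS.
  have Exy : x = y by apply/enum_rank_inj/val_inj; rewrite /= rx Hy.
  by rewrite -Exy in HyS *; exact: H2.
have [Hin Hle] := H y Hy HyS; split; first by rewrite mem_cat Hin.
by case: E2 => _ _ _ C; rewrite (leq_trans (C _ Hin)).
Qed.

Lemma den_cut q s S : inv q s ->
  (forall i, i < #|G| -> ar s aBit i = bit S i) ->
  vr (den cut_loop s) vCut = cut S.
Proof.
move=> Iq EB; rewrite den_cut_loop ?(inv_one Iq) // (inv_n Iq) sum_enum_rank.
apply: eq_bigr => x _; rewrite sum_enum_rank; apply: eq_bigr => y _.
rewrite !EB // !bit_rank (inv_adj Iq).
by case: (x \in S); case: (y \in S).
Qed.

Lemma den_visit q s h : inv q s -> vr s vHead = h -> h < size q ->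
  exists q1, [/\ extends #|nth set0 q h|.+1 q s q1 (den visit s),
    vr (den visit s) vHead = h.+1 &
    good k (nth set0 q h) -> forall x, x \notin nth set0 q h ->
      x |: nth set0 q h \in q ++ q1 /\
      val_of (den visit s) (x |: nth set0 q h)
        <= val_of s (nth set0 q h) + cut (nth set0 q h)].
Proof.
move=> Iq Hh hq; set S := nth set0 q h.
rewrite /visit 7!den_cons den_nil.
set s1 := den (CAdd vHead _ _) _; set s2 := den decode s1.
set s3 := den cut_loop s2; set s4 := den (CAdd vTmp _ _) s3.
set s5 := den (CSub _ _ _) s4.
have I1 : inv q s1 by exact: inv_eq Iq _ _ _ _ _.
have I2 : inv q s2.
  apply: inv_eq I1 _ _ _ _ _; rewrite ?(@den_vr_frame decode) //.
  by move=> a; rewrite !inE => /or4P[] /eqP ->; exact: (@den_ar_frame decode).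
have I3 : inv q s3.
  apply: inv_eq I2 _ _ _ _ _; rewrite ?(@den_vr_frame cut_loop) //.
  by move=> a; rewrite !inE => /or4P[] /eqP ->; exact: (@den_ar_frame cut_loop).
have I5 : inv q s5 by exact: inv_eq I3 _ _ _ _ _.
have M1 : vr s1 vMask = code S by rewrite /= /upd /= Hh (inv_queue Iq).
have B2 i : i < #|G| -> ar s2 aBit i = bit S i.
  move=> Hi; apply: den_decode; rewrite ?(inv_one I1) ?(inv_n I1) //.
    exact: (inv_pow I1).
  by rewrite M1 codeE.
have C3 : vr s3 vCut = cut S by exact: (den_cut I2 B2).
have B5 i : i < #|G| -> ar s5 aBit i = bit S i.
  by move=> Hi; rewrite -[ar s5]/(ar s3) (@den_ar_frame cut_loop) // B2.
have M5 : vr s5 vMask = code S.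
  rewrite -[vr s5 _]/(vr s3 vMask) (@den_vr_frame cut_loop) //.
  by rewrite (@den_vr_frame decode).
have h5 : vr s5 vHead = h.+1.
  rewrite -[vr s5 _]/(vr s3 vHead) (@den_vr_frame cut_loop) //.
  by rewrite (@den_vr_frame decode) // /= /upd /= Hh (inv_one Iq) addn1.
have T5 : (vr s5 vTmp == 0) = good k S.
  rewrite /= /upd /= C3 (inv_thr I3) subn_eq0 /good.
  by rewrite addnn.
have V5 : ar s5 aVal = ar s aVal.
  rewrite -[ar s5]/(ar s3) (@den_ar_frame cut_loop) //.
  by rewrite (@den_ar_frame decode).
rewrite -[den (CIf _ _ _) s5]/(if vr s5 vTmp == 0 then den push s5 else s5) T5.
case: ifP => gS; last first.
  by exists [::]; split=> //; apply: extends_inv.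
have Sq : S \in q by exact: mem_nth.
have [q1 [E H]] := den_push I5 Sq M5 B5 C3 gS.
have vE T : val_of s5 T = val_of s T by rewrite /val_of V5.
exists q1; split.
- case: E => A1 A2 A3 A4; split=> // T HT; first by rewrite A3.
  by rewrite -(vE T) A4.
- by rewrite (@den_vr_frame push).
- by move=> _ x Hx; rewrite -vE; exact: H.
Qed.

(** * Layers of the search and their cost *)

(** The unread part of the queue is the layer of cardinality [j]. The last clause and [inv_reach]
    together make its values minimal, which suffices because every path to cardinality [j + 1]
    passes through this layer. *)
Definition at_layer j q s : Prop :=
  [/\ inv q s, vr s vHead <= size q,
      forall i, i < vr s vHead -> #|nth set0 q i| < j,
      forall i, vr s vHead <= i < size q -> #|nth set0 q i| = j
    & forall T (y : nat), reach k T y -> #|T| = j -> T \in q /\ val_of s T <= y.+1].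

Lemma den_layer j q s : at_layer j q s ->
  vr (den layer s) vHead = size q /\
  exists q1, at_layer j.+1 (q ++ q1) (den layer s).
Proof.
move=> [Iq hq Hlt Heq Hreach]; rewrite /layer 2!den_cons den_nil.
set s1 := den _ s; set h := vr s vHead.
have I1 : inv q s1 by exact: inv_eq Iq _ _ _ _ _.
have c1 : vr s1 vCount = size q - h by rewrite /= /upd /= (inv_tail Iq).
pose I i s' := exists q1, [/\ extends j.+1 q s q1 s', vr s' vHead = h + i
  & forall l, l < i -> let S := nth set0 q (h + l) in
     good k S -> forall x, x \notin S ->
      x |: S \in q ++ q1 /\ val_of s' (x |: S) <= val_of s S + cut S].
have [q1 [E Hh H]] : I (vr s1 vCount) (den (CRep vCount visit) s1).
  apply: den_rep.
    exists [::]; split=> //; first exact: extends_inv.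
    by rewrite addn0.
  rewrite c1 => i s' Hi [q1 [E Hh H]].
  have [I' Hc' Hv' Hm'] := E.
  have hi : h + i < size (q ++ q1) by rewrite size_cat; lia.
  have hiq : h + i < size q by lia.
  have [q2 [E2 Hh2 H2]] := den_visit I' Hh hi.
  have nE : nth set0 (q ++ q1) (h + i) = nth set0 q (h + i) by rewrite nth_cat hiq.
  rewrite nE Heq in E2; last by rewrite -/h; lia.
  rewrite nE in H2.
  exists (q1 ++ q2); split.
  - exact: extends_trans E E2.
  - by rewrite Hh2 addnS.
  move=> l; rewrite ltnS leq_eqVlt catA => /orP[/eqP ->|Hl] S gS x Hx.
    rewrite -(Hv' S); first exact: H2.
    by rewrite /S Heq -/h; lia.
  have [Hin Hle] := H l Hl gS x Hx; split; first by rewrite mem_cat Hin.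
  by case: E2 => _ _ _ C; rewrite (leq_trans (C _ Hin)).
have {}Hh : vr (den (CRep vCount visit) s1) vHead = size q by rewrite Hh c1; lia.
split=> //; exists q1; case: E => I' Hc' Hv' Hm'; split=> //; rewrite ?Hh.
- by rewrite size_cat leq_addr.
- move=> i Hi; rewrite nth_cat Hi ltnS.
  by case: (ltnP i h) => Hih; [rewrite ltnW // Hlt|rewrite Heq // -/h Hih].
- move=> i /andP[Hi Hi']; rewrite nth_cat ltnNge Hi /=.
  by apply/Hc'/mem_nth; rewrite ltn_subLR // -size_cat.
(* The last step of a path to [T] leaves a good set [S] of layer [j], which lies in the part of the
   queue just read. *)
move=> T x [|S v y rS gS vS] cT; first by rewrite cards0 in cT.
have cS : #|S| = j by move: cT; rewrite cardsU1 vS; lia.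
have [Sq Sle] := Hreach S y rS cS.
have Hidx : h <= index S q.
  by rewrite leqNgt; apply/negP => /Hlt; rewrite nth_index // cS ltnn.
have Hn : nth set0 q (h + (index S q - h)) = S by rewrite subnKC // nth_index.
have Hl : index S q - h < vr s1 vCount.
  by rewrite c1 ltn_sub2r // ?index_mem // (leq_ltn_trans Hidx) // index_mem.
have := H _ Hl; rewrite Hn => /(_ gS v vS)[Hin Hle]; split=> //.
by apply: leq_trans Hle _; rewrite -addSn leq_add2r.
Qed.

(** Queued sets may be bad, but each nonempty one is a good set plus one vertex. *)
Lemma size_queue q s : inv q s -> size q <= (#|G| * #|[set S : {set G} | good k S]|).+1.
Proof.
move=> Iq; rewrite -(card_uniqP (inv_uniq Iq)).
pose E := set0 |: [set p.1 |: p.2 | p in setX [set: G] [set S : {set G} | good k S]].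
apply: (@leq_trans #|E|).
  apply: subset_leq_card; apply/subsetP => S /(inv_reach Iq) rS.
  case: rS => [|T v y _ gT _]; first by rewrite !inE eqxx.
  by rewrite inE; apply/orP; right; apply/imsetP; exists (v, T); rewrite ?inE.
rewrite cardsU1 -add1n leq_add ?leq_b1 // -cardsT -cardsX.
exact: leq_imset_card.
Qed.

Record fresh (s : state) : Prop := Fresh {
  fresh_n : vr s vN = #|G|;
  fresh_k : vr s vK = k;
  fresh_adj : forall x y,
    ar s aAdj (enum_rank x * #|G| + enum_rank y + 2) = adj x y;
  fresh_val : forall i, ar s aVal i = 0;
  fresh_queue : forall i, ar s aQueue i = 0 }.

Lemma den_start s : fresh s ->
  [/\ at_layer 0 [:: set0] (den start s), vr (den start s) vHead = 0,
      vr (den start s) vEdges = edges G, vr (den start s) vPow = 2 ^ #|G|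
    & vr (den start s) vK = k].
Proof.
case=> Hn Hk Ha Hv Hq; rewrite /start 8!den_cons den_nil.
set s1 := den (CAdd vThr _ _) _; set s2 := den pow_loop s1.
set s3 := den edge_loop s2; set s4 := den (CPut _ _ _) _.
have [P2 A2] := @den_pow_loop s1 erefl.
have one2 : vr s2 vOne = 1 by rewrite (@den_vr_frame pow_loop).
have n2 : vr s2 vN = #|G| by rewrite (@den_vr_frame pow_loop).
have adj2 : ar s2 aAdj = ar s aAdj by rewrite (@den_ar_frame pow_loop).
have M3 : vr s3 vEdges = edges G.
  rewrite den_edge_loop // n2 adj2 sum_enum_rank; apply: eq_bigr => x _.
  rewrite sum_enum_rank; apply: eq_bigr => y _; rewrite Ha.
  by case: ltnP; rewrite ?andbT ?andbF.
have v4 r : r \in [:: vN; vK; vOne; vThr] -> vr s4 r = vr s1 r.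
  by rewrite !inE => /or4P[] /eqP ->; rewrite -[LHS]/(vr s3 _)
    (@den_vr_frame edge_loop) // (@den_vr_frame pow_loop).
have a3 a : a \in [:: aAdj; aVal; aQueue] -> ar s3 a = ar s a.
  by rewrite !inE => /or3P[] /eqP ->; rewrite (@den_ar_frame edge_loop) //
    (@den_ar_frame pow_loop).
have one3 : vr s3 vOne = 1 by rewrite (@den_vr_frame edge_loop).
have val4 S : val_of s4 S = (S == set0).
  rewrite /val_of /= /upd /= a3 // Hv one3 -{1}code0 (inj_eq code_inj).
  by case: eqP.
split=> //; last by rewrite v4.
  split=> //.
  - split=> //; rewrite ?v4 //.
    + by rewrite /= /upd /= Hk.
    + move=> i Hi; rewrite -[ar s4 _]/(ar s3 aPow) (@den_ar_frame edge_loop) //.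
      by rewrite A2 // /s1 /= /upd /= Hn.
    + by move=> x y; rewrite -[ar s4 _]/(ar s3 aAdj) a3.
    + by case=> // _; rewrite -[ar s4 _]/(ar s3 aQueue) a3 // Hq code0.
    + by move=> S; rewrite val4 inE; case: eqP.
    + by move=> S; rewrite val4 inE => /eqP ->; rewrite eqxx; exact: reach0.
  - by case=> // _; rewrite cards0.
  - move=> T y [|S v z _ _ vS]; first by rewrite val4 inE eqxx.
    by rewrite cardsU1 vS.
rewrite -[LHS]/(vr s3 vPow) (@den_vr_frame edge_loop) //.
by rewrite P2 -Hn.
Qed.

(** [comp] bounds the entry of the full set from above by an optimal arrangement that survives
    pruning; [snd] bounds it from below, since an entry comes from an arrangement. *)
Lemma den_finish q s : at_layer #|G| q s -> vr s vEdges = edges G ->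
  vr s vPow = 2 ^ #|G| -> vr s vK = k ->
  vr (den finish s) vN = (ola_plus G <= k) /\
  (ola_plus G <= k -> vr (den finish s) vK = ola_plus G).
Proof.
case=> Iq _ _ _ Hreach Hm Hp Hk.
have [[alpha la Ha] Hmin] := ola_plusP G.
have vE : ar s aVal (vr s vPow - vr s vOne) = val_of s setT.
  by rewrite /val_of codeT Hp (inv_one Iq).
have comp : ola_plus G <= k -> 0 < val_of s setT <= (ola_plus G + edges G).+1.
  rewrite -{1}Ha => Hle; have := reach_arrangement la Hle; rewrite Ha => rT.
  have [Tq ->] := Hreach _ _ rT (cardsT _).
  by rewrite (inv_gt0 Iq Tq).
have snd : 0 < val_of s setT -> ola_plus G + edges G <= (val_of s setT).-1.
  move=> v0; have Tq : setT \in q by rewrite (inv_mem Iq) -lt0n.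
  have [beta lb <-] := arrangement_of_reach (inv_reach Iq Tq).
  by rewrite leq_add2r Hmin.
have one := inv_one Iq.
rewrite /= /upd /= vE; move: comp snd; set v := val_of s setT => comp snd.
case: (v =P 0) => v0 /=.
  by split; case: leqP => // /comp; rewrite v0.
rewrite /upd /= one Hm Hk; have v1 : 0 < v by lia.
have := snd v1 => Hv.
case: (boolP (v - 1 - edges G - k == 0)) => Hc /=; rewrite /upd /=.
  have Hle : ola_plus G <= k by lia.
  by rewrite Hle; split=> // _; have /andP[_] := comp Hle; lia.
have Hgt : (ola_plus G <= k) = false.
  by apply/negP => Hle; have /andP[_] := comp Hle; lia.
by rewrite Hgt.
Qed.

(** The visits of all layers together number at most [n * N + 1]; 8 is the overhead of one layer and
    100 covers [finish]. *)
Definition search_cost (n N : nat) : nat :=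
  bound 3 start n + (n * 8 + 3 + (bound 3 visit n + 4) * (n * N).+1) + 100.

(** The queue head is the potential: a layer costs a constant plus [B] for each place the head
    advances, and the head never passes the end of the queue. *)
Lemma den_search s : fresh s ->
  [/\ vr (den search s) vN = (ola_plus G <= k),
      ola_plus G <= k -> vr (den search s) vK = ola_plus G &
      cost 3 search s <= search_cost #|G| #|[set S : {set G} | good k S]|].
Proof.
move=> fs; have [L0 h0 M1 P1 K1] := den_start fs.
set s1 := den start s in L0 h0 M1 P1 K1.
pose I i s' := exists q, at_layer i q s'.
have n1 : vr s1 vN = #|G| by case: L0 => /inv_n.
set B := bound 3 visit #|G| + 4.
have stp i s' : i < vr s1 vN -> I i s' -> I i.+1 (den layer s') /\
    cost 3 layer s' + B * vr s' vHead <= 4 + B * vr (den layer s') vHead.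
  move=> _ [q Lq]; have [Hh [q1 Lq1]] := den_layer Lq.
  split; first by exists (q ++ q1).
  rewrite Hh; case: Lq => Iq hq _ _ _.
  rewrite -[cost 3 layer s']/(1 + (cost 3 (CRep vCount visit) _ + 0)) addn0.
  set s2 := den _ s'.
  have c2 : vr s2 vCount = size q - vr s' vHead by rewrite /= /upd /= (inv_tail Iq).
  have n2 : vr s2 vN = #|G| by exact: (inv_n Iq).
  have : cost 3 (CRep vCount visit) s2 <= vr s2 vCount * B + 3.
    apply: cost_rep => i' _; apply: leq_trans (cost_bound (x := vN) _ _ _ _) _ => //.
    suff -> : vr (iter i' (den visit) s2) vN = #|G| by [].
    by elim: i' => [|i' IH]; [exact: n2|rewrite iterS (@den_vr_frame visit)].
  rewrite c2 => Hc.
  have -> : B * size q = (size q - vr s' vHead) * B + B * vr s' vHead.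
    by rewrite [B * vr s' vHead]mulnC -mulnDl subnK // mulnC.
  by lia.
have I0 : I 0 s1 by exists [:: set0].
set s2 := den (CRep vN layer) s1.
have [q Lq] : I #|G| s2.
  by rewrite -n1; apply: den_rep => // i s' Hi Ii; case: (stp i s' Hi Ii).
have Hc := @cost_rep_potential 3 I (fun s' => vr s' vHead) vN layer s1 B 4 I0 stp.
have fr r : r \in [:: vEdges; vPow; vK] -> vr s2 r = vr s1 r.
  by rewrite !inE => /or3P[] /eqP ->; exact: (@den_vr_frame (CRep vN layer)).
rewrite /search 3!den_cons den_nil -/s1 -/s2.
have [||| R0 R1] := den_finish Lq; rewrite ?fr //.
split=> //.
rewrite -[cost _ _ _]/(cost 3 start s + (cost 3 (CRep vN layer) s1
  + (cost 3 finish s2 + 0))) addn0 /search_cost -addnA leq_add //.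
  apply: leq_trans (cost_bound (x := vN) _ _ _ _) _ => //.
  by rewrite (fresh_n fs).
apply: leq_add; last first.
  (* [finish] has no loops, so any variable that it does not write will do; it writes [vN]. *)
  by apply: leq_trans (cost_bound (x := 2) _ _ _ _) _.
move: Hc; rewrite h0 muln0 addn0 n1 => Hc; apply: leq_trans Hc _.
rewrite leq_add2l leq_mul2l; apply/orP; right.
by case: Lq => Iq hq _ _ _; apply: leq_trans hq (size_queue Iq).
Qed.

End Search.

(** * The complete program *)

Lemma nth_allpairs (A B : Type) (x0 : A) (y0 : B) (f : A -> B -> nat) s t i j :
  i < size s -> j < size t ->
  nth 0 [seq f x y | x <- s, y <- t] (i * size t + j) = f (nth x0 s i) (nth y0 t j).
Proof.
elim: s i => // x s IH [|i] Hi Hj; rewrite allpairs_cons nth_cat size_map.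
  by rewrite mul0n Hj (nth_map y0).
rewrite ifF; last by rewrite mulSn; lia.
by rewrite mulSn -addnA addKn IH.
Qed.

Section Encoding.

Variables (G : sgraph) (k : nat).
Let m := encode G k.

Lemma size_adj_matrix :
  size [seq nat_of_bool (adj u v) | u <- enum G, v <- enum G] = #|G| * #|G|.
Proof. by rewrite size_allpairs -!cardE. Qed.

Lemma encode_bit p : m p.+2 <= 1.
Proof.
rewrite /m /encode /=.
case: (ltnP p (size [seq nat_of_bool (adj u v) | u <- enum G, v <- enum G])) => Hp.
  have /allpairsP[[u v] [_ _ ->]] := mem_nth 0 Hp.
  exact: leq_b1.
by rewrite nth_default.
Qed.

Lemma encode_default p : (#|G| * #|G|).+1 < p -> m p = 0.
Proof.
by move=> Hp; apply: nth_default; rewrite size_cat size_adj_matrix.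
Qed.

Lemma encode_adj (x y : G) : m (enum_rank x * #|G| + enum_rank y + 2) = adj x y.
Proof.
have := @nth_allpairs G G x x (fun u v => adj u v) (enum G) (enum G)
  (enum_rank x) (enum_rank y).
by rewrite -cardE !nth_enum_rank addn2 /m /encode /=; apply; rewrite ltn_ord.
Qed.

End Encoding.

(** Three views of one memory: 26 plain variables, then 20 variables and a single array from
    register 26 on, then the same with 8 interleaved arrays. The 6 registers in between are two
    scratch registers and counters for the four nested loops of the search. Registers 2 to 25 hold
    the 24 bits to be packed. *)
Definition prog_pack := compile 26 0 0 (pack 23) 0 0.
Definition prog_relocate := compile 20 6 0 relocate (size prog_pack) 0.
Definition prog_search :=
  compile 20 6 3 search (size prog_pack + size prog_relocate) 0.
Definition prog : program := prog_pack ++ prog_relocate ++ prog_search.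

(** Every memory represents the state read off from it; this permits the change of view between
    phases. *)
Lemma represents_view NV X J m :
  represents NV X J (State m (fun a i => m (NV + X + (2 ^ J * i + a)))) m.
Proof. by []. Qed.

Lemma code_at_cat3 (p1 p2 p3 : program) : let P := p1 ++ p2 ++ p3 in
  [/\ code_at P 0 p1, code_at P (size p1) p2 & code_at P (size p1 + size p2) p3].
Proof.
have C : code_at (p1 ++ p2 ++ p3) 0 (p1 ++ p2 ++ p3) by [].
by have [C1 /code_at_cat[C2 C3]] := code_at_cat C.
Qed.

(** The 126 is 1 for the initial constant and 125 for the 24 rounds of [power_loop]. *)
Definition relocate_cost (n : nat) : nat :=
  bound 0 square n + bound 0 shift (n * n) + bound 0 unpack 24 + 126.

Lemma cost_relocate s :
  cost 0 relocate s <= relocate_cost (vr s 0).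
Proof.
rewrite /relocate /relocate_cost.
set s1 := den (CConst 3 1) s; set s2 := den square s1; set s3 := den shift s2.
set s4 := den power_loop s3.
rewrite -[cost 0 (seqc _) s]/(1 + (cost 0 square s1 + (cost 0 shift s2
  + (cost 0 power_loop s3 + (cost 0 unpack s4 + 0))))).
have H1 : cost 0 square s1 <= bound 0 square (vr s 0).
  by apply: leq_trans (cost_bound (x := 0) _ _ _ _) _.
have H2 : cost 0 shift s2 <= bound 0 shift (vr s 0 * vr s 0).
  apply: leq_trans (cost_bound (x := 4) _ _ _ _) _ => //.
  by rewrite den_square.
have H4 : cost 0 unpack s4 <= bound 0 unpack 24.
  by apply: leq_trans (cost_bound (x := 4) _ _ _ _) _.
have H3 : cost 0 power_loop s3 <= 125.
  set t := den (CConst 4 24) (den (CConst 9 1) s3).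
  rewrite -[cost _ _ _]/(1 + (1 + (cost 0 (CRep 4 (CAdd 9 9 9)) t + 0))).
  have : cost 0 (CRep 4 (CAdd 9 9 9)) t <= vr t 4 * (1 + 4) + 3.
    by apply: cost_rep.
  by rewrite -[vr t 4]/24; move: (cost _ _ _); lia.
lia.
Qed.

(** The 46 steps are the two additions at each of the 23 levels of [pack 23]. *)
Definition total_cost (n N : nat) : nat := 46 + relocate_cost n + search_cost n N.

Lemma size_cat3 (T : Type) (p1 p2 p3 : seq T) :
  size (p1 ++ p2 ++ p3) = size p1 + size p2 + size p3.
Proof. by rewrite !size_cat addnA. Qed.

Lemma size_prog :
  size prog = size prog_pack + size prog_relocate + size prog_search.
Proof. exact (size_cat3 prog_pack prog_relocate prog_search). Qed.

Lemma prog_solves (G : sgraph) (k : nat) : exists2 t,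
  t <= total_cost #|G| #|[set S : {set G} | good k S]| &
  solves_within prog G k t.
Proof.
set m := encode G k.
set s0 := State m (fun a i => m (26 + 0 + (2 ^ 0 * i + a))).
have [C0 C1 C2] := code_at_cat3 prog_pack prog_relocate prog_search.
rewrite -/prog in C0 C1 C2.
have [m1 [E1 R1 _]] := @compileP 26 0 0 prog (pack 23) 0 0 s0 m isT C0
  (represents_view 26 0 0 m).
set s1 := State m1 (fun a i => m1 (20 + 6 + (2 ^ 0 * i + a))).
have [m2 [E2 R2 _]] := @compileP 20 6 0 prog relocate _ 0 s1 m1 isT C1
  (represents_view 20 6 0 m1).
set s2 := State m2 (fun a i => m2 (20 + 6 + (2 ^ 3 * i + a))).
have [m3 [E3 R3 _]] := @compileP 20 6 3 prog search _ 0 s2 m2 isT C2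
  (represents_view 20 6 3 m2).
have [P2 Px] := den_pack 23 s0.
have m1E x : x < 26 -> x != 2 -> m1 x = m x.
  by move=> Hx H2; rewrite (proj1 R1 x Hx) (Px x H2).
have m1A i : m1 (26 + i) = m (26 + i).
  have := proj2 R1 0 i isT.
  by rewrite (@den_ar_frame (pack 23) s0 0 isT) [ar s0 0 i]/= mul1n !addn0.
have n1 : vr s1 0 = #|G| by rewrite /= m1E.
have m2A i a : a < 8 -> m2 (26 + (8 * i + a)) = if (a == 0) && (1 < i) then m i else 0.
  move=> Ha; have E : m2 (26 + (8 * i + a)) = ar (den relocate s1) 0 (8 * i + a).
    have := proj2 R2 0 (8 * i + a) isT.
    by rewrite [X in m2 (_ + X)]addn0 [X in m2 (_ + X)]mul1n.
  rewrite E; apply: (den_relocate _ _ _ _ _ Ha).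
  - exact: encode_bit.
  - by rewrite n1; exact: encode_default.
  - exact: etrans (proj1 R1 2 isT) P2.
  - by move=> j; rewrite -m1A [LHS]/= mul1n addn0.
have fr : fresh G k s2.
  split.
  - exact: etrans (proj1 R2 0 isT) (etrans (@den_vr_frame relocate s1 0 isT) n1).
  - apply: etrans (proj1 R2 1 isT) (etrans (@den_vr_frame relocate s1 1 isT) _).
    exact: m1E.
  - move=> x y; rewrite -(encode_adj k x y) -/m.
    apply: etrans (m2A _ 0 isT) _.
    by rewrite addn2.
  (* The relocation leaves 0 in every cell off residue 0 modulo 8, so the value table and the queue
     start blank. *)
  - by move=> i; exact (m2A i 1 isT).
  - by move=> i; exact (m2A i 2 isT).
have [D0 D1 Dc] := den_search fr.
exists (cost 3 search s2 + (cost 0 relocate s1 + cost 0 (pack 23) s0)).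
  rewrite /total_cost [X in X <= _]addnC; apply: leq_add; last exact: Dc.
  rewrite [X in X <= _]addnC; apply: leq_add.
    exact: leq_trans (@cost_bound 0 26 (pack 23) s0 isT isT) _.
  by rewrite -n1; exact: cost_relocate.
rewrite /solves_within -/m.
have -> : run prog m (cost 3 search s2 + (cost 0 relocate s1 + cost 0 (pack 23) s0))
    = Config (size prog) m3.
  rewrite /run iterD [iter (_ + _) _ _]iterD E1 E2 E3 size_prog.
  reflexivity.
split; first exact: leqnn.
split=> [|/D1 <-]; first exact: etrans (proj1 R3 0 isT) D0.
exact: proj1 R3 1 isT.
Qed.

Lemma run_halted P m t t' : t <= t' -> halted P (run P m t) ->
  run P m t' = run P m t.
Proof.
move=> /subnKC <- H; rewrite addnC /run iterD -/(run P m t).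
elim: (t' - t) => //= i ->; rewrite /step onth_default //.
Qed.

Lemma solves_within_mono P G k t t' : t <= t' ->
  solves_within P G k t -> solves_within P G k t'.
Proof. by move=> Ht [H1 H2]; rewrite /solves_within (run_halted Ht H1). Qed.

(** * Running time *)

Definition set_bound (k : nat) : nat :=
  (10 ^ (5 * k + 2) * 3 ^ (k + 6)) %/ 9 ^ (5 * k + 2).

(** The bound [(10/9) ^ n * 3 ^ (k + 6)] grows with [n], so its value at [n = 5k + 2] covers all
    smaller graphs and depends on [k] alone. *)
Lemma card_good_set_bound (G : sgraph) k : connected_graph G ->
  #|G| <= 5 * k + 2 -> #|[set S : {set G} | good k S]| <= set_bound k.
Proof.
move=> cG Hn; have := card_good k cG; rewrite /set_bound leq_divRL ?expn_gt0 //.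
rewrite -(subnKC Hn); move: (_ - _) #|[set _ | _]| (3 ^ _) => d N t H.
rewrite !expnD mulnA; apply: leq_trans (leq_mul H (leqnn _)) _.
by rewrite -!mulnA [t * _]mulnC !leq_mul //; case: d => // d; rewrite leq_exp2r.
Qed.

Lemma total_cost_mono n n' N N' : n <= n' -> N <= N' ->
  total_cost n N <= total_cost n' N'.
Proof.
move=> Hn HN; rewrite /total_cost /relocate_cost /search_cost.
rewrite !(leq_add, leq_mul, bound_mono, ltnS) //.
Qed.

Definition time (k : nat) : nat := total_cost (5 * k + 2) (set_bound k).

Lemma prog_time (G : sgraph) k : connected_graph G -> #|G| <= 5 * k + 2 ->
  solves_within prog G k (time k).
Proof.
move=> cG Hn; have [t Ht] := prog_solves G k; apply: solves_within_mono.
apply: leq_trans Ht _; apply: total_cost_mono => //.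
exact: card_good_set_bound.
Qed.

Fixpoint depth (c : cmd) : nat :=
  match c with
  | CSeq c1 c2 | CIf _ c1 c2 => maxn (depth c1) (depth c2)
  | CRep _ c1 => (depth c1).+1
  | _ => 0
  end.

Lemma bound_poly J c n e : depth c <= e ->
  bound J c n <= bound J c 1 * n.+1 ^ e.
Proof.
have M m : 0 < n.+1 ^ m by rewrite expn_gt0.
elim: c e => //= [x y|x y z|x y z|x y z|x y z|c1 IH1 c2 IH2|x c1 IH1 c2 IH2|x c IH] e;
  try by move=> _; rewrite leq_pmulr.
- rewrite geq_max => /andP[H1 H2]; rewrite mulnDl leq_add ?IH1 ?IH2 //.
- rewrite geq_max => /andP[H1 H2]; rewrite !mulnDl !leq_add ?IH1 ?IH2 //.
  by rewrite leq_pmulr.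
- case: e => // e /IH Hc; rewrite mul1n mulnDl leq_add ?leq_pmulr //.
  rewrite expnS mulnCA leq_mul // mulnDl leq_add // leq_pmulr //.
Qed.

(** The leading term is at most [n * N + 1] visits with two nested loops each; relocation is
    quadratic in [n]. *)
Lemma total_cost_poly : exists C, forall n N,
  total_cost n N <= C * (n.+1 ^ 3 * N.+1).
Proof.
exists (46 + (bound 0 square 1 + bound 0 shift 1 + bound 0 unpack 24 + 126)
  + (bound 3 start 1 + (8 + 3 + (bound 3 visit 1 + 4)) + 100)) => n N.
have P1 e : e <= 3 -> n.+1 ^ e <= n.+1 ^ 3 * N.+1.
  by move=> He; rewrite -[X in X <= _]muln1 leq_mul // leq_pexp2l.
have P0 := P1 0 isT; rewrite expn0 in P0.
have E : n.+1 ^ 3 * N.+1 = n.+1 ^ 2 * (n.+1 * N.+1) by rewrite expnSr mulnA.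
have L : (n * N).+1 <= n.+1 * N.+1 by nia.
have h1 : bound 0 square n <= bound 0 square 1 * (n.+1 ^ 3 * N.+1).
  apply: leq_trans (@bound_poly 0 square n 1 isT) _.
  by apply: leq_mul => //; apply: P1.
have h2 : bound 0 shift (n * n) <= bound 0 shift 1 * (n.+1 ^ 3 * N.+1).
  apply: leq_trans (@bound_poly 0 shift (n * n) 1 isT) _; apply: leq_mul => //.
  by apply: leq_trans (P1 2 isT); rewrite expn1 expnS expn1; nia.
have h3 : bound 3 start n <= bound 3 start 1 * (n.+1 ^ 3 * N.+1).
  apply: leq_trans (@bound_poly 3 start n 2 isT) _.
  by apply: leq_mul => //; apply: P1.
have h4 : n <= n.+1 ^ 3 * N.+1 by apply: leq_trans (P1 1 isT); rewrite expn1.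
have h5 : (bound 3 visit n + 4) * (n * N).+1
    <= (bound 3 visit 1 + 4) * (n.+1 ^ 3 * N.+1).
  rewrite E mulnA; apply: leq_mul => //; rewrite mulnDl; apply: leq_add.
    exact: bound_poly.
  by rewrite leq_pmulr ?expn_gt0.
rewrite /total_cost /relocate_cost /search_cost.
move: h1 h2 h3 h4 h5 P0 {E L P1}; move: (n.+1 ^ 3 * N.+1) => P.
move: (bound 0 square n) (bound 0 square 1) (bound 0 shift _) (bound 0 shift 1)
  (bound 3 start n) (bound 3 start 1) (_ * (n * N).+1) (bound 3 visit 1)
  (bound 0 unpack 24) => a1 b1 a2 b2 a3 b3 a5 b5 a6.
nia.
Qed.

(** Bernoulli's inequality for [1 + 1/40]. The cubic factor thus costs a rate [(41/40) ^ 3], below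
    1.08, which keeps the total under [28/5]. *)
Lemma succ_le_expn k : k.+1 * 40 ^ k <= 40 * 41 ^ k.
Proof.
elim: k => // k IH; rewrite !expnS.
have : 40 ^ k <= 41 ^ k by case: k {IH} => // k; rewrite leq_exp2r.
by move: IH; move: (40 ^ k) (41 ^ k) => a b; nia.
Qed.

Lemma leq_mul_swap C a b c d e f g h : a * b <= c * d -> e * f <= g * h ->
  C * (a * e) * (f * b) <= C * c * g * (h * d).
Proof.
move=> H1 H2; rewrite -!(mulnA C) leq_mul2l; apply/orP; right.
by rewrite [f * b]mulnC [h * d]mulnC mulnACA [X in _ <= X]mulnACA leq_mul.
Qed.

(** Denominators are cleared so that the estimate with rate [(10/9) ^ 5 * 3 * (41/40) ^ 3] stays in
    [nat]. *)
Lemma time_le : exists C, forall k,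
  time k * (9 ^ 5 * 40 ^ 3) ^ k <= C * (10 ^ 5 * 3 * 41 ^ 3) ^ k.
Proof.
have [C HC] := total_cost_poly.
exists (C * (5 ^ 3 * 40 ^ 3) * (2 * (10 ^ 2 * 3 ^ 6))) => k.
have H1 : (5 * k + 2).+1 ^ 3 * (40 ^ 3) ^ k <= 5 ^ 3 * 40 ^ 3 * (41 ^ 3) ^ k.
  rewrite -!expnM ![3 * k]mulnC !expnM -!expnMn leq_exp2r // -mulnA.
  apply: leq_trans (leq_mul (leqnn 5) (succ_le_expn k)).
  by rewrite mulnA leq_mul2r; apply/orP; right; lia.
have H2 : (set_bound k).+1 * (9 ^ 5) ^ k <= 2 * (10 ^ 2 * 3 ^ 6) * (10 ^ 5 * 3) ^ k.
  set A := 10 ^ (5 * k + 2) * 3 ^ (k + 6).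
  have EA : A = 10 ^ 2 * 3 ^ 6 * (10 ^ 5 * 3) ^ k.
    rewrite /A (expnD 10 (5 * k) 2) (expnD 3 k 6) (expnM 10 5 k) (expnMn (10 ^ 5) 3 k).
    by rewrite mulnACA mulnC.
  (* As [A] is at least the divisor, the successor of the quotient costs only a factor 2. *)
  have HA : 9 ^ (5 * k + 2) <= A.
    by rewrite -[X in X <= _]muln1 leq_mul ?expn_gt0 // leq_exp2r // addn2.
  have : (set_bound k).+1 * 9 ^ (5 * k + 2) <= 2 * A.
    by rewrite mulSn mul2n -addnn leq_add // leq_trunc_div.
  rewrite -mulnA -EA; apply: leq_trans; rewrite leq_mul2l expnD expnM.
  by rewrite leq_pmulr ?expn_gt0 ?orbT.
apply: leq_trans (leq_mul (HC _ _) (eq_leq (expnMn (9 ^ 5) (40 ^ 3) k))) _.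
apply: leq_trans (leq_mul_swap C H1 H2) _.
by apply: eq_leq; congr (_ * _); exact (esym (expnMn (10 ^ 5 * 3) (41 ^ 3) k)).
Qed.

(* Required only here because classical_sets shadows the names of finset. *)
From mathcomp Require Import all_boot all_order all_algebra.
From mathcomp Require Import all_classical all_reals all_analysis.
From mathcomp Require Import lra.
Import Order.TTheory GRing.Theory Num.Theory numFieldNormedType.Exports.
Local Open Scope classical_set_scope.
Local Open Scope ring_scope.

(** * Passage to real exponents *)

(** After squaring, [31.36 <= 32 = 2 ^ 5]. The rational [28/5] separates the rate of the algorithm,
    about 5.47, from [2 ^ (5/2)]. *)
Lemma base_le_powR (R : realType) (c : R) : 5 / 2 <= c -> 28 / 5 <= 2 `^ c.
Proof.
move=> Hc; rewrite -ler_sqr ?nnegrE ?powR_ge0 ?divr_ge0 //.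
rewrite -[X in _ <= X]powR_mulrn ?powR_ge0 // -powRrM.
apply: (@le_trans _ _ (2 `^ 5%:R)); first by rewrite powR_mulrn //; lra.
by apply: ler_powR; lra.
Qed.

(** With variables for the bases the cast is pure rewriting and no large unary number is
    evaluated. *)
Lemma natr_growth_le (R : realType) (t a b C c d e k : nat) :
  (t * (a ^ 5 * b ^ 3) ^ k <= C * (c ^ 5 * d * e ^ 3) ^ k)%N ->
  t%:R * (a%:R ^+ 5 * b%:R ^+ 3) ^+ k
    <= C%:R * (c%:R ^+ 5 * d%:R * e%:R ^+ 3) ^+ k :> R.
Proof. by rewrite -(ler_nat R) !(natrM, natrX). Qed.

Lemma time_growth (R : realType) : exists2 C : R, 0 < C &
  forall k, (time k)%:R <= C * (28 / 5) ^+ k.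
Proof.
have [C HC] := time_le; exists (C%:R + 1) => [|k].
  by rewrite ltr_wpDl.
pose D : R := 9 ^+ 5 * 40 ^+ 3; pose E : R := 10 ^+ 5 * 3 * 41 ^+ 3.
have D0 : 0 < D by rewrite mulr_gt0 // exprn_gt0.
have ED : E <= 28 / 5 * D by rewrite /E /D; lra.
have {}HC : (time k)%:R * D ^+ k <= C%:R * E ^+ k.
  exact (@natr_growth_le R (time k) 9 40 C 10 3 41 k (HC k)).
rewrite -(ler_pM2r (exprn_gt0 k D0)); apply: le_trans HC _.
rewrite -mulrA -exprMn; apply: ler_pM.
- exact: ler0n.
- by rewrite exprn_ge0 // !mulr_ge0 // exprn_ge0.
- by rewrite lerDl.
- by rewrite lerXn2r // nnegrE ?mulr_ge0 ?exprn_ge0 ?divr_ge0 // ltW.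
Qed.

Theorem theorem3p6 (R : realType) :
  exists (P : program) (time : nat -> nat),
    ((fun k : nat => (time k)%:R : R) =O_\oo
       (fun k : nat =>
          2 `^ ((2 + 5 / 10 + 5 / 10 ^+ 2 + 5 / 10 ^+ 3 + 1 / 10 ^+ 4) * k%:R)
          : R))
    /\ forall (G : sgraph) (k : nat),
         connected_graph G -> (#|G| <= 5 * k + 2)%N ->
         solves_within P G k (time k).
Proof.
exists prog, time; split; last exact: prog_time.
have [C C0 HC] := time_growth R.
apply/eqO_exP; exists C => //; apply: filterE => k.
rewrite ger0_norm // ger0_norm ?powR_ge0 //; apply: le_trans (HC k) _.
rewrite ler_pM2l // powRrM powR_mulrn ?powR_ge0 //.
(* The decimal exponent is compared with [5 / 2]. *)
rewrite lerXn2r ?nnegrE ?powR_ge0 ?divr_ge0 // base_le_powR //; lra.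
Qed.
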